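(* Let $X$ be a topological space, let $C_\bullet(X)$ denote its singular chain complex (over $\mathbb{Z}$), and let $i\geqslant0$. Suppose that we have a coproduct $\Delta'_i\colon C_\bullet(X)\to C_\bullet(X)\otimes C_\bullet(X)$ (a degree-$i$ linear map) such that the formula for $\Delta'_i(\sigma)$ does not depend upon the particular singular simplex $\sigma\colon\Delta^p\to X$, but only on its dimension $p$. Suppose further that $$\partial\circ\Delta'_i-(-1)^i\,\Delta'_i\circ\partial=(1+(-1)^iT)\,\Delta_{i-1}^{\emptyset},$$ that $\Delta'_i$ has the minimal number of terms among all the coproducts satisfying this equation, and, if $i=0$, that $\Delta'_i(\sigma)=\sigma\otimes\sigma$ for each singular $0$-simplex $\sigma$. Then $\Delta'_i=\Delta_i^{\emptyset}$ or $\Delta'_i=(-1)^i\,T\Delta_i^{\emptyset}$.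
   Context: Notation. $[0,p]=\{0,\dots,p\}$. $\binom{S}{k}$ is the set of $k$-element subsets of $S$; $|S|_{<x}=|\{s\in S: s<x\}|$, $|S|_{>x}=|\{s\in S:s>x\}|$. On $C_\bullet(X)\otimes C_\bullet(X)$, $\partial(x\otimes y)=\partial x\otimes y+(-1)^{\deg x}x\otimes\partial y$ and $T(x\otimes y)=(-1)^{\deg x\deg y}\,y\otimes x$. For a singular simplex $\sigma\colon\Delta^p\to X$ and non-empty $Y\subseteq[0,p]$, $\sigma|_Y$ denotes the singular $(|Y|-1)$-simplex obtained by restricting $\sigma$ to the face of $\Delta^p$ with vertex set $Y$ (vertices in increasing order). That the formula for $\Delta'_i(\sigma)$ depends only on the dimension of $\sigma$ means that there are integers $c_p^{Y,Z}$, independent of $\sigma$, with $\Delta'_i(\sigma)=\sum_{Y,Z}c_p^{Y,Z}\,\sigma|_Y\otimes\sigma|_Z$ for all singular simplices $\sigma\colon\Delta^p\to X$, the sum being over non-empty $Y,Z\subseteq[0,p]$. For $i\geqslant0$, the coproduct $\Delta_i^{\emptyset}$ on $C_\bullet(X)$ is given, for $\sigma\colon\Delta^p\to X$ and with $S=[0,p]$, by $$\Delta_i^{\emptyset}(\sigma)=\sum_{L\in\binom{S}{i+1}}(-1)^{\varepsilon}\,\sigma|_{L\cup A_L}\otimes\sigma|_{L\cup B_L},\qquad A_L=\{a\in S\setminus L: |L|_{>a}\text{ odd}\},\quad B_L=S\setminus(L\cup A_L),$$ with $\varepsilon=\sum_{b\in B_L}|A_L|_{<b}+\sum_{l\in L}|L|_{<l}+(p+1)|A_L|$.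 By convention $\Delta_{-1}^{\emptyset}=0$.
   Formalization: X is assumed to have enough singular simplices that the integers c_p^{Y,Z} are determined by the values of the formula on X; for X a point and i=0 the claim fails, since Δ'(σ)=σ⊗σ in dimension 0 and Δ'=0 above is a solution with fewer terms. *)

(* Defs.v *)
From HB Require Import structures.
From mathcomp Require Import all_boot all_order all_algebra.
From mathcomp Require Import all_classical all_reals all_analysis.
From mathcomp.multinomials Require Import freeg.

Set Implicit Arguments.
Unset Strict Implicit.
Unset Printing Implicit Defensive.

Import Order.TTheory GRing.Theory Num.Theory.
Import numFieldNormedType.Exports.

Local Open Scope ring_scope.

Section FreeLift.
Variables (S : choiceType) (M : lmodType int) (f : S -> M).

Lemma fglift_is_linear : linear (fglift f : {freeg S / int} -> M).
Proof.
have fgD (x y : {freeg S / int}) : fglift f (x + y) = fglift f x + fglift f y.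
  have H := @lift_is_additive int S M f.
  have fg0 : fglift f 0 = 0 by rewrite -{1}(subrr 0) H subrr.
  have fgN z : fglift f (- z) = - fglift f z by rewrite -sub0r H fg0 sub0r.
  by rewrite -{1}(opprK y) H fgN opprK.
have fg0 : fglift f 0 = 0 by apply: (addrI (fglift f 0)); rewrite -fgD !addr0.
move=> a u v; rewrite fgD; congr (_ + _).
rewrite -(freeg_sumE u); elim: (dom u) => [|k r IH].
  by rewrite !big_nil scaler0 fg0 scaler0.
rewrite !big_cons scalerDr !fgD IH scalerDr; congr (_ + _).
have -> : a *: << coeff k u *g k >> = << a * coeff k u *g k >> :> {freeg S / int}.
  by apply/eqP/freeg_eqP => z; rewrite coeffZ !coeffU mulrA.
by rewrite !liftU scalerA.
Qed.

HB.instance Definition _ :=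
  GRing.isLinear.Build int {freeg S / int} M *:%R (fglift f) fglift_is_linear.

Definition lin_ext : {linear {freeg S / int} -> M} := fglift f.

Lemma lin_extU s : lin_ext << s >> = f s.
Proof. by rewrite /lin_ext /= liftU scale1r. Qed.

Lemma lin_extE x : lin_ext x = \sum_(s <- dom x) coeff s x *: f s.
Proof.
rewrite -{1}(freeg_sumE x) raddf_sum /=; apply: eq_bigr => s _.
by rewrite liftU.
Qed.

Lemma lin_ext_unique (g : {freeg S / int} -> M) :
  linear g -> (forall s, g << s >> = f s) -> g =1 lin_ext.
Proof.
move=> lg gf x.
pose gl : {linear {freeg S / int} -> M} :=
  HB.pack g (GRing.isLinear.Build int {freeg S / int} M *:%R g lg).
rewrite -[g x]/(gl x) -{1}(freeg_sumE x) raddf_sum lin_extE.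
apply: eq_bigr => s _.
have -> : << coeff s x *g s >> = coeff s x *: << s >> :> {freeg S / int}.
  by apply/eqP/freeg_eqP => z; rewrite coeffZ !coeffU mul1r.
by rewrite -gf; exact: (linearZ_LR gl).
Qed.

End FreeLift.

Section StandardSimplex.
Variable R : realType.

Definition simplex (p : nat) : set 'rV[R]_p.+1 :=
  [set t : 'rV[R]_p.+1 | (forall j, 0 <= t 0 j) /\ \sum_j t 0 j = 1]%classic.
Arguments simplex : clear implicits.

Definition vertex (p : nat) (a : 'I_p.+1) : 'rV[R]_p.+1 := delta_mx 0 a.

Lemma vertex_simplex p (a : 'I_p.+1) : vertex a \in simplex p.
Proof.
apply/mem_set; split=> [j|]; first by rewrite mxE ler0n.
rewrite (bigD1 a) //= big1 => [|j /negPf ja]; rewrite mxE ?eqxx ?ja ?andbF //=.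
by rewrite addr0.
Qed.

Definition simplex_vertex p (a : 'I_p.+1) : simplex p :=
  exist _ (vertex a) (vertex_simplex a).

Definition affine_fun (k p : nat) (f : 'I_k.+1 -> 'I_p.+1)
    (t : 'rV[R]_k.+1) : 'rV[R]_p.+1 :=
  \sum_a t 0 a *: vertex (f a).

Lemma affine_simplex k p (f : 'I_k.+1 -> 'I_p.+1) (t : simplex k) :
  affine_fun f (set_val t) \in simplex p.
Proof.
case: t => t ht; have [t0 t1] := set_mem ht.
apply/mem_set; rewrite set_valE /=; split.
  move=> j; rewrite summxE; apply: sumr_ge0 => a _.
  by rewrite !mxE mulr_ge0 // ler0n.
under eq_bigr do rewrite summxE.
rewrite exchange_big /= -[RHS]t1; apply: eq_bigr => a _.
under eq_bigr do rewrite mxE.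
have /set_mem [_ v1] := vertex_simplex (f a).
by rewrite -mulr_sumr v1 mulr1.
Qed.

Definition affine k p (f : 'I_k.+1 -> 'I_p.+1) (t : simplex k) : simplex p :=
  exist _ (affine_fun f (set_val t)) (affine_simplex f t).

Lemma lincomb_continuous k (w : 'I_k.+1 -> R) :
  continuous (fun u : 'rV[R]_k.+1 => \sum_a u 0 a * w a).
Proof.
elim: (index_enum _) => [|a r IH] u.
  rewrite (_ : (fun _ => _) = cst 0); first exact: (@cst_continuous _ R).
  by apply/funext => v; rewrite big_nil.
rewrite (_ : (fun _ => _) = (fun v : 'rV[R]_k.+1 => v 0 a * w a +
    \sum_(b <- r) v 0 b * w b)); last first.
  by apply/funext => v; rewrite big_cons.
apply: cvgD; [exact: nbhs_filter | | exact: IH].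
apply: (@continuous_comp _ _ _ (fun v : 'rV[R]_k.+1 => v 0 a)
  (fun x => x * w a)); first exact: coord_continuous.
exact: mulrr_continuous.
Qed.

Lemma affine_fun_continuous k p (f : 'I_k.+1 -> 'I_p.+1) :
  continuous (affine_fun f).
Proof.
move=> t A [P Pnbhs PA].
suff H i j : \forall u \near t, P i j (affine_fun f u i j).
  have : \forall u \near t, forall i j, P i j (affine_fun f u i j).
    apply: (filter_forall (nbhs_filter t)) => i.
    by apply: (filter_forall (nbhs_filter t)) => j; exact: H.
  by apply: filterS => u Pu; exact: PA.
have cf : continuous (fun u : 'rV[R]_k.+1 => affine_fun f u i j).
  rewrite (_ : (fun _ => _) =
      (fun u : 'rV[R]_k.+1 => \sum_a u 0 a * vertex (f a) i j)).
    exact: lincomb_continuous.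
  by apply/funext => u; rewrite summxE; apply: eq_bigr => a _; rewrite mxE.
exact: (cf t _ (Pnbhs i j)).
Qed.

Lemma affine_continuous k p (f : 'I_k.+1 -> 'I_p.+1) : continuous (affine f).
Proof.
apply: continuous_comp_initial => t.
apply: (@continuous_comp _ _ _ set_val (affine_fun f)).
  exact: initial_continuous.
exact: affine_fun_continuous.
Qed.

HB.instance Definition _ k p (f : 'I_k.+1 -> 'I_p.+1) :=
  @isContinuous.Build (simplex k) (simplex p) (affine f) (@affine_continuous k p f).

Lemma affine_vertex k p (f : 'I_k.+1 -> 'I_p.+1) (a : 'I_k.+1) :
  affine f (simplex_vertex a) = simplex_vertex (f a).
Proof.
apply: val_inj => /=; rewrite /affine_fun set_valE /= (bigD1 a) //=.
rewrite big1 => [|j ja]; rewrite mxE ?eqxx ?scale1r ?addr0 //=.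
by rewrite (negPf ja) scale0r.
Qed.

End StandardSimplex.

Arguments simplex : clear implicits.

(* A table of coefficients [c p Y Z], defining on any space a map that sends
   a singular p-simplex s to the sum of the [c p Y Z *: s|_Y (x) s|_Z]. *)
Definition coefficients := forall p, {set 'I_p.+1} -> {set 'I_p.+1} -> int.

Section SingularChains.
Variables (R : realType) (X : topologicalType).

Definition ssimplex (p : nat) : choiceType := continuousType (simplex R p) X.

(* Singular simplices of all dimensions; [tag s] is the dimension of [s]. *)
Definition sing : choiceType := {p : nat & ssimplex p}.

Definition chain := {freeg sing / int}.

(* Increasing enumeration of the vertices of [Y]; it is only meaningful for
   [Y] non-empty. *)
Definition vertex_of p (Y : {set 'I_p.+1}) (a : 'I_(#|Y|.-1.+1)) : 'I_p.+1 :=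
  nth ord0 (enum Y) a.

Definition restr p (s : continuousType (simplex R p) X) (Y : {set 'I_p.+1}) :
    sing :=
  Tagged ssimplex (s \o affine (R := R) (@vertex_of p Y) : continuousType _ _).

Definition boundary_simplex (s : sing) : chain :=
  if tag s == 0%N then 0
  else \sum_(k < (tag s).+1) (-1) ^+ k *: << restr (tagged s) [set~ k]%SET >>.

Definition boundary : {linear chain -> chain} := lin_ext boundary_simplex.

(* The tensor product over Z of two copies of the free module [chain], realised
   as the free module on pairs of generators; see [tensor_universal]. *)
Definition chain2 := {freeg (sing * sing)%type / int}.

Definition tensor (x y : chain) : chain2 :=
  lin_ext (fun s => lin_ext (fun t => << (s, t) >> : chain2) y) x.

Lemma tensorU s t : tensor << s >> << t >> = << (s, t) >>.
Proof. by rewrite /tensor !lin_extU. Qed.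

Lemma tensor_linearl y : linear (tensor^~ y).
Proof. by move=> a x x'; rewrite /tensor linearP. Qed.

Lemma tensor_linearr x : linear (tensor x).
Proof.
move=> a y y'; rewrite /tensor !lin_extE scaler_sumr -big_split /=.
by apply: eq_bigr => s _; rewrite linearP scalerDr !scalerA mulrC.
Qed.

Lemma tensor_universal (M : lmodType int) (f : chain -> chain -> M) :
  (forall y, linear (f^~ y)) -> (forall x, linear (f x)) ->
  exists g : {linear chain2 -> M}, (forall x y, g (tensor x y) = f x y) /\
    forall g' : {linear chain2 -> M},
      (forall x y, g' (tensor x y) = f x y) -> g' =1 g.
Proof.
move=> fl fr; pose g := lin_ext (fun st : sing * sing => f << st.1 >> << st.2 >>).
exists g; split=> [x y|g' Hg'].
  have Hl := lin_ext_unique (fl y) (fun s => erefl).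
  rewrite Hl; apply: (lin_ext_unique (g := fun x => g (tensor x y))) => [a x1 x2|s].
    by rewrite tensor_linearl linearP.
  have Hr := lin_ext_unique (fr << s >>) (fun t => erefl).
  rewrite Hr; apply: (lin_ext_unique (g := fun y => g (tensor << s >> y))) => [a y1 y2|t].
    by rewrite tensor_linearr linearP.
  by rewrite tensorU lin_extU.
apply: lin_ext_unique => [a u v|[s t]]; first by rewrite linearP.
by rewrite -tensorU Hg'.
Qed.

Definition boundary2 : {linear chain2 -> chain2} :=
  lin_ext (fun st => tensor (boundary << st.1 >>) << st.2 >> +
    (-1) ^+ tag st.1 *: tensor << st.1 >> (boundary << st.2 >>)).

Definition swap : {linear chain2 -> chain2} :=
  lin_ext (fun st => (-1) ^+ (tag st.1 * tag st.2)%N *: tensor << st.2 >> << st.1 >>).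

Definition has_degree (i : nat) (D : chain -> chain2) : Prop :=
  forall (s : sing) (st : sing * sing), st \in dom (D << s >>) ->
    (tag st.1 + tag st.2 = tag s + i)%N.

Definition formula_value p (c : {set 'I_p.+1} -> {set 'I_p.+1} -> int)
    (s : ssimplex p) : chain2 :=
  \sum_(Y : {set 'I_p.+1} | (0 < #|Y|)%N) \sum_(Z : {set 'I_p.+1} | (0 < #|Z|)%N)
    c Y Z *: tensor << restr s Y >> << restr s Z >>.

Section Steenrod.
Variables (p : nat) (L : {set 'I_p.+1}).

Definition Aset : {set 'I_p.+1} :=
  [set a | (a \notin L) && odd #|[set l in L | (a < l)%N]|]%SET.

Definition Bset : {set 'I_p.+1} := (~: (L :|: Aset))%SET.

Definition sign_exponent : nat :=
  (\sum_(b in Bset) #|[set a in Aset | (a < b)%N]%SET| +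
  \sum_(l in L) #|[set k in L | (k < l)%N]%SET| + p.+1 * #|Aset|)%N.

End Steenrod.

Definition Delta_simplex (i p : nat) (s : ssimplex p) : chain2 :=
  \sum_(L : {set 'I_p.+1} | #|L| == i.+1) (-1) ^+ sign_exponent L *:
    tensor << restr s (L :|: Aset L)%SET >> << restr s (L :|: Bset L)%SET >>.

(* The index is an integer so as to include the convention in degree -1. *)
Definition Delta (i : int) : {linear chain -> chain2} :=
  lin_ext (fun s => if i is Posz n then Delta_simplex n (tagged s) else 0).

Definition given_by (c : coefficients)
    (D : chain -> chain2) : Prop :=
  forall (p : nat) (s : ssimplex p),
    D << Tagged ssimplex s >> = formula_value (c p) s.

Definition coproduct_equation (i : nat) (D : chain -> chain2) : Prop :=
  forall x : chain, boundary2 (D x) - (-1) ^+ i *: D (boundary x) =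
    Delta (i%:Z - 1) x + (-1) ^+ i *: swap (Delta (i%:Z - 1) x).

(* In degree 0 the coproduct is normalised on 0-simplices: without this, 0 would
   satisfy the equation with no term at all. *)
Definition admissible (i : nat) (D : {linear chain -> chain2})
    (c : coefficients) : Prop :=
  [/\ has_degree i D, given_by c D, coproduct_equation i D &
      i = 0%N -> forall s : sing, tag s = 0%N ->
        D << s >> = tensor << s >> << s >>].

(* Speaking of the terms of a coproduct presupposes that the coefficients can be
   read off from its values on the simplices of X. This fails on spaces with too
   few simplices, such as a point, where all the restrictions of a simplex to
   faces of a given dimension coincide; [distinct_vertices_determined] and
   [injective_line_determined] give sufficient conditions. *)
Definition formulas_determined : Prop :=
  forall (p : nat) (e : {set 'I_p.+1} -> {set 'I_p.+1} -> int),
    (forall s : ssimplex p, formula_value e s = 0) ->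
    forall Y Z : {set 'I_p.+1}, (0 < #|Y|)%N -> (0 < #|Z|)%N -> e Y Z = 0.

Definition vertex_set (s : sing) : set X :=
  [set x | exists a : 'I_(tag s).+1,
     (tagged s : continuousType (simplex R (tag s)) X) (simplex_vertex R a) = x]%classic.

Lemma restr_inj p (s : continuousType (simplex R p) X) (Y Z : {set 'I_p.+1}) :
  injective (fun a : 'I_p.+1 => s (simplex_vertex R a)) ->
  (0 < #|Y|)%N -> (0 < #|Z|)%N -> restr s Y = restr s Z -> Y = Z.
Proof.
move=> s_inj Y0 Z0 /(congr1 vertex_set).
suff H (W : {set 'I_p.+1}) : (0 < #|W|)%N -> forall b,
    vertex_set (restr s W) (s (simplex_vertex R b)) <-> b \in W.
  move=> eqYZ; apply/setP => b.
  by apply/idP/idP => /H; [rewrite eqYZ|rewrite -eqYZ] => /(_ _)/H; apply.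
move=> W0 b; split=> [[a /=]|bW].
  rewrite affine_vertex => /s_inj <-.
  rewrite /vertex_of -mem_enum mem_nth // -cardE.
  by apply: (leq_trans (ltn_ord a)); rewrite /= prednK.
have ib : (index b (enum W) < #|W|.-1.+1)%N.
  by rewrite prednK // cardE index_mem mem_enum.
by exists (Ordinal ib) => /=; rewrite affine_vertex /vertex_of nth_index ?mem_enum.
Qed.

Lemma formula_value_coeff p (e : {set 'I_p.+1} -> {set 'I_p.+1} -> int)
    (s : continuousType (simplex R p) X) (Y Z : {set 'I_p.+1}) :
  injective (fun a : 'I_p.+1 => s (simplex_vertex R a)) ->
  (0 < #|Y|)%N -> (0 < #|Z|)%N ->
  coeff (restr s Y, restr s Z) (formula_value e s) = e Y Z.
Proof.
move=> s_inj Y0 Z0; rewrite /formula_value raddf_sum (bigD1 Y) //= raddf_sum.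
rewrite (bigD1 Z) //= coeffZ tensorU coeffU eqxx !mulr1.
rewrite big1 ?addr0 => [|Z' /andP[Z'0 Z'Z]]; last first.
  rewrite coeffZ tensorU coeffU xpair_eqE eqxx /=.
  case: eqP => [/(restr_inj s_inj Z'0 Z0) /eqP|]; last by rewrite mulr0n !mulr0.
  by rewrite (negPf Z'Z).
rewrite big1 ?addr0 // => Y' /andP[Y'0 Y'Y]; rewrite raddf_sum big1 // => Z' _.
rewrite /= coeffZ tensorU coeffU xpair_eqE.
case: eqP => [/(restr_inj s_inj Y'0 Y0) /eqP|]; last by rewrite mulr0n !mulr0.
by rewrite (negPf Y'Y).
Qed.

Lemma distinct_vertices_determined :
  (forall p, exists s : continuousType (simplex R p) X,
     injective (fun a : 'I_p.+1 => s (simplex_vertex R a))) ->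
  formulas_determined.
Proof.
move=> H p e e0 Y Z Y0 Z0; have [s s_inj] := H p.
by rewrite -(formula_value_coeff e s_inj Y0 Z0) (e0 s) coeff0.
Qed.

Lemma injective_line_determined (g : continuousType R X) :
  injective g -> formulas_determined.
Proof.
move=> g_inj; apply: distinct_vertices_determined => p.
pose h (t : simplex R p) : R := \sum_a set_val t 0 a * (a : nat)%:R.
have hc : continuous h.
  move=> t; apply: (@continuous_comp _ _ _ set_val
    (fun u : 'rV[R]_p.+1 => \sum_a u 0 a * (a : nat)%:R)).
    exact: initial_continuous.
  exact: lincomb_continuous.
exists (g \o mkcts hc : continuousType _ _) => a b /= /g_inj.
have hv (k : 'I_p.+1) : mkcts hc (simplex_vertex R k) = (k : nat)%:R.
  rewrite /mkcts /h set_valE /= (bigD1 k) //= !mxE !eqxx mul1r.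
  rewrite big1 ?addr0 // => j /negPf jk.
  by rewrite mxE jk andbF mul0r.
by rewrite !hv => /eqP; rewrite eqr_nat => /eqP /val_inj.
Qed.

End SingularChains.

Definition nterms (c : coefficients)
    (p : nat) : nat :=
  #|[set YZ : {set 'I_p.+1} * {set 'I_p.+1} |
      [&& (0 < #|YZ.1|)%N, (0 < #|YZ.2|)%N & c p YZ.1 YZ.2 != 0]]%SET|.

(* Main.v *)
Require Import Defs.
From HB Require Import structures.
From mathcomp Require Import all_boot all_order all_algebra.
From mathcomp Require Import all_classical all_reals all_analysis.
From mathcomp.multinomials Require Import freeg.
From mathcomp Require Import zify.

Set Implicit Arguments.
Unset Strict Implicit.
Unset Printing Implicit Defensive.

Import Order.TTheory GRing.Theory Num.Theory.
Import numFieldNormedType.Exports.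

Local Open Scope ring_scope.

(* A pair of faces (Y, Z) of the p-simplex covering all its vertices is a face of
   the (p+1)-cube: each vertex is in Y only, in Z only, or in both, the last ones
   being the free directions L = Y :&: Z. Modulo pairs that do not cover, the
   boundary of the tensor product is the cubical one, so the covering part of any
   two solutions differs by a cubical (i+1)-cycle, and projecting this cycle to
   the cube of directions L kills it. Hence the signed number of terms parallel to
   each L with #|L| = i+1 is 1 for every solution, as it is for Steenrod's; a
   minimal solution has exactly one term for each L and no non-covering term.
   The boundary terms missing one vertex say that these choices are compatible with
   faces, so they are determined by those in dimension i+1. There, the equation
   along the two-element complements of the i-element sets shows that the choice
   agrees with Steenrod's either for every L or for none, which gives the two
   solutions. *)

(** * Signs of pairs of faces *)

Lemma eq_sign (m n : nat) : odd m = odd n -> (-1) ^+ m = (-1) ^+ n :> int.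
Proof. by move=> e; rewrite -signr_odd e signr_odd. Qed.

Lemma mulr_transfer (x y s t : int) :
  s * s = 1 -> t * t = 1 -> x * s = y * t -> t * x = y * s.
Proof.
by move=> s1 t1 e; rewrite -[LHS]mulr1 -s1 mulrA -(mulrA t) e mulrCA t1 mulr1.
Qed.

(** The parity count behind [sg_swap]: [a], [b] and [m] are the sizes of [Y :\: Z], [Z :\: Y] and
    [Y :&: Z], [i] and [j] count the inversions between the first two in either order, and [k] those
    inside the overlap. *)
Lemma swap_parity (n m a b i j k : nat) :
    (a + b + m = n -> i + j = a * b -> 0 < m + a -> 0 < m + b ->
  odd (m + (m + a).-1 * (m + b).-1 + (j + k + n * b)) =
  odd (1 + (i + k + n * a)))%N.
Proof.
move=> <- /(congr1 odd); rewrite oddD oddM => eij ma0 mb0.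
have oa : odd (m + a).-1 = ~~ (odd m (+) odd a) by move: ma0; clear; lia.
have ob : odd (m + b).-1 = ~~ (odd m (+) odd b) by move: mb0; clear; lia.
rewrite !(oddD, oddM) oa ob; move: eij {oa ob ma0 mb0}.
by move: (odd m) (odd a) (odd b) (odd i) (odd j) (odd k) =>
  [] [] [] [] [] [].
Qed.

Lemma sum_ltn (n k : nat) : (k <= n)%N -> (\sum_(x < n) (x < k)%N = k)%N.
Proof.
move=> kn; rewrite -(big_mkord xpredT (fun x => nat_of_bool (x < k)%N)).
have minE m : (\sum_(0 <= x < m) (x < k)%N = minn m k)%N.
  elim: m => [|m IH]; first by rewrite big_nil min0n.
  by rewrite big_nat_recr //= IH /minn; case: (ltnP m k); case: (ltnP m.+1 k); lia.
by rewrite minE; apply/minn_idPr.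
Qed.

Section Counting.
Variable n : nat.
Implicit Types (W A B L : {set 'I_n}) (x y : 'I_n).

Definition below W (x : nat) : nat := \sum_(w in W) (w < x)%N.
Definition above W (x : nat) : nat := \sum_(w in W) (x < w)%N.

Lemma belowE W (x : nat) : #|[set w in W | (w < x)%N]| = below W x.
Proof.
rewrite -sum1dep_card big_mkcondr /below.
by apply: eq_bigr => w _; case: ifP.
Qed.

Lemma aboveE W (x : nat) : #|[set w in W | (x < w)%N]| = above W x.
Proof.
rewrite -sum1dep_card big_mkcondr /above.
by apply: eq_bigr => w _; case: ifP.
Qed.

Lemma belowU1 W x (y : nat) : x \notin W ->
  below (x |: W) y = ((x < y) + below W y)%N.
Proof. by move=> xW; rewrite /below big_setU1. Qed.

Lemma aboveU1 W x (y : nat) : x \notin W ->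
  above (x |: W) y = ((y < x) + above W y)%N.
Proof. by move=> xW; rewrite /above big_setU1. Qed.

Lemma card_below_above W x : x \notin W -> #|W| = (below W x + above W x)%N.
Proof.
move=> xW; rewrite -sum1_card -big_split /=; apply: eq_bigr => w wW.
by case: ltngtP => // /val_inj wx; rewrite -wx wW in xW.
Qed.

Definition inversions A B : nat := \sum_(b in B) below A b.

Lemma inversionsU1r A B x : x \notin B ->
  inversions A (x |: B) = (below A x + inversions A B)%N.
Proof. by move=> xB; rewrite /inversions big_setU1. Qed.

Lemma inversionsU1l A B x : x \notin A ->
  inversions (x |: A) B = (above B x + inversions A B)%N.
Proof.
move=> xA; rewrite /inversions /above -big_split /=.
by apply: eq_bigr => b _; rewrite belowU1.
Qed.

Lemma inversionsU1 L x : x \notin L ->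
  inversions (x |: L) (x |: L) = (#|L| + inversions L L)%N.
Proof.
move=> xL; rewrite inversionsU1l // inversionsU1r // aboveU1 // ltnn add0n.
by rewrite (card_below_above xL); lia.
Qed.

Lemma inversions_sym A B : [disjoint A & B] ->
  (inversions A B + inversions B A = #|A| * #|B|)%N.
Proof.
move=> dAB; have -> : inversions B A = \sum_(b in B) above A b.
  by rewrite /inversions /below exchange_big.
rewrite -big_split /= mulnC -sum_nat_const; apply: eq_bigr => b bB.
rewrite /below /above -big_split /= -sum1_card; apply: eq_bigr => a aA.
case: ltngtP => // /val_inj ab; move/disjointFr: dAB => /(_ _ aA).
by rewrite ab bB.
Qed.

(** The exponent of Steenrod's formula, extended to every pair of faces by taking [Y :\: Z],
    [Z :\: Y] and [Y :&: Z] for A, B and L; in dimension p it is used with n = p + 1. *)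
Definition sg_exponent (Y Z : {set 'I_n}) : nat :=
  (inversions (Y :\: Z) (Z :\: Y) + inversions (Y :&: Z) (Y :&: Z) +
   n * #|Y :\: Z|)%N.

Definition sg (Y Z : {set 'I_n}) : int := (-1) ^+ sg_exponent Y Z.

Lemma sg_sqr Y Z : sg Y Z * sg Y Z = 1.
Proof. by rewrite /sg -expr2 sqrr_sign. Qed.

Lemma sg_neq0 Y Z : sg Y Z != 0.
Proof. by rewrite signr_eq0. Qed.

Lemma card_full_pair (Y Z : {set 'I_n}) : Y :|: Z = [set: 'I_n]%SET ->
  (#|Y :\: Z| + #|Z :\: Y| + #|Y :&: Z| = n)%N.
Proof.
move=> full; have := cardsT 'I_n; rewrite card_ord -full cardsU.
have := cardsID Z Y; have := cardsID Y Z; rewrite (finset.setIC Z Y).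
have : (#|Y :&: Z| <= #|Y|)%N by rewrite subset_leq_card // finset.subsetIl.
lia.
Qed.

Lemma below_partition (Y Z : {set 'I_n}) x : 
  below Y x = (below (Y :&: Z) x + below (Y :\: Z) x)%N.
Proof. by rewrite {1}/below (big_setID Z). Qed.

(** Once corrected by [sg], the sign of a simplicial face depends only on the position of [l]
    relative to the overlap. This is what turns the boundary into a cubical one. *)
Lemma sg_extend_left (Y Z : {set 'I_n}) l : l \notin Y -> l \in Z ->
  (-1) ^+ below Y l * sg (l |: Y) Z = (-1) ^+ above (Y :&: Z) l * sg Y Z.
Proof.
move=> lY lZ; rewrite /sg -!exprD; apply: eq_sign; rewrite /sg_exponent.
have -> : (l |: Y) :\: Z = Y :\: Z.
  by apply/setP=> x; rewrite !inE; case: eqP => // ->; rewrite lZ.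
have -> : (l |: Y) :&: Z = l |: (Y :&: Z).
  by apply/setP=> x; rewrite !inE; case: eqP => // ->; rewrite lZ.
have -> : Z :\: Y = l |: (Z :\: (l |: Y)).
  by apply/setP=> x; rewrite !inE; case: eqP => // ->; rewrite lZ lY.
have lM : l \notin Y :&: Z by rewrite inE (negPf lY).
rewrite (inversionsU1 lM) inversionsU1r; last by rewrite !inE eqxx.
by rewrite (below_partition Y Z) (card_below_above lM); lia.
Qed.

(** Removing [l] from [Y :\: Z] changes the exponent by n, which a covering pair splits into three
    cardinals. What remains is opposite to the sign on the left: the two ends of an edge of the cube
    are oppositely oriented. *)
Lemma sg_extend_right (Y Z : {set 'I_n}) l : Y :|: Z = [set: 'I_n]%SET ->
    l \in Y -> l \notin Z ->
  (-1) ^+ (#|Y|.+1 + below Z l) * sg Y (l |: Z) =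
  (-1) ^+ (above (Y :&: Z) l).+1 * sg Y Z.
Proof.
move=> full lY lZ; have := card_full_pair full.
rewrite -(cardsID Z Y).
rewrite /sg -!exprD => np; apply: eq_sign; rewrite /sg_exponent.
move: np.
have -> : (l |: Z) :\: Y = Z :\: Y.
  by apply/setP=> x; rewrite !inE; case: eqP => // ->; rewrite lY.
have -> : Y :&: (l |: Z) = l |: (Y :&: Z).
  by apply/setP=> x; rewrite !inE; case: eqP => // ->; rewrite lY.
have -> : Y :\: Z = l |: (Y :\: (l |: Z)).
  by apply/setP=> x; rewrite !inE; case: eqP => // ->; rewrite lZ lY.
have lM : l \notin Y :&: Z by rewrite inE (negPf lZ) andbF.
have lA : l \notin Y :\: (l |: Z) by rewrite !inE eqxx.
have lB : l \notin Z :\: Y by rewrite !inE lY.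
rewrite (inversionsU1 lM) inversionsU1l // cardsU1 lA.
rewrite (below_partition Z Y) (finset.setIC Z Y).
have := card_below_above lM; have := card_below_above lB.
move: (below _ _) (below _ _) (above _ _) (above _ _) => b1 b2 a1 a2.
move: (inversions _ _) (inversions _ _) #|_| #|_| #|_| => i1 i2 c1 c2 c3.
move=> -> -> <-; rewrite mulnDr oddD; lia.
Qed.

(** The sign of T and the change of normalisation combine to (-1)^(m+1), which depends on the size
    of the overlap alone, so T acts uniformly on the terms of one degree. *)
Lemma sg_swap (Y Z : {set 'I_n}) m : Y :|: Z = [set: 'I_n]%SET -> #|Y :&: Z| = m ->
    (0 < #|Y|)%N -> (0 < #|Z|)%N ->
  (-1) ^+ (m + #|Y|.-1 * #|Z|.-1) * sg Z Y = - sg Y Z.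
Proof.
move=> full cM Y0 Z0; have -> : - sg Y Z = (-1) ^+ 1 * sg Y Z by rewrite expr1 mulN1r.
rewrite /sg -!exprD.
apply: eq_sign; rewrite /sg_exponent (finset.setIC Z Y).
have dAB : [disjoint Y :\: Z & Z :\: Y].
  by rewrite -finset.setI_eq0; apply/eqP/setP=> x; rewrite !inE; do 2!case: (_ \in _).
move: Y0 Z0; rewrite -(cardsID Z Y) -(cardsID Y Z) (finset.setIC Z Y) cM.
by apply: swap_parity; rewrite ?inversions_sym // -cM card_full_pair.
Qed.

(** Coefficients relative to Steenrod's signs: his own terms get coefficient 1. *)
Definition nrm (e : {set 'I_n} -> {set 'I_n} -> int) (Y Z : {set 'I_n}) : int :=
  sg Y Z * e Y Z.

Lemma nrm_eq0 e Y Z : (nrm e Y Z == 0) = (e Y Z == 0).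
Proof. by rewrite mulf_eq0 (negPf (sg_neq0 _ _)). Qed.

(** The boundary in transposed form: the coefficient at [(Y, Z)] collects the pairs of which it is a
    face. The exponent [#|Y|.+1] has the parity of the dimension of [Y], without a truncated
    predecessor. *)
Definition bd (e : {set 'I_n} -> {set 'I_n} -> int) (Y Z : {set 'I_n}) : int :=
  \sum_(y | y \notin Y) (-1) ^+ below Y y * e (y |: Y) Z +
  \sum_(z | z \notin Z) (-1) ^+ (#|Y|.+1 + below Z z) * e Y (z |: Z).

Lemma setU_eqT (Y Z : {set 'I_n}) x :
  Y :|: Z = [set: 'I_n]%SET -> (x \in Y) || (x \in Z).
Proof. by move/setP/(_ x); rewrite !inE. Qed.

(** In a covering pair a vertex outside the overlap lies on exactly one side, so adding it to the
    other side amounts to adding it to both. The term [l \in Y] of the exponent tells at which end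
    of the edge the pair lies. *)
Lemma bd_full e (Y Z : {set 'I_n}) : Y :|: Z = [set: 'I_n]%SET ->
  sg Y Z * bd e Y Z = \sum_(l | l \notin Y :&: Z)
    (-1) ^+ (above (Y :&: Z) l + (l \in Y)) * nrm e (l |: Y) (l |: Z).
Proof.
move=> full; rewrite /bd mulrDr !big_distrr /= [RHS](bigID (mem Y)) /= [LHS]addrC.
congr (_ + _); apply: eq_big => [l|l].
- rewrite !inE; move: (setU_eqT l full).
  by case: (l \in Y) => /=; rewrite ?andbT ?andbF // => ->.
- move=> lZ; have lY : l \in Y by move: (setU_eqT l full); rewrite (negPf lZ) orbF.
  rewrite lY addn1 (_ : l |: Y = Y); last first.
    by apply/finset.setUidPr; rewrite finset.sub1set.
  rewrite mulrA /nrm mulrA; congr (_ * _).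
  by apply: mulr_transfer; rewrite ?sg_sqr // sg_extend_right.
- by rewrite !inE; case: (l \in Y); rewrite ?andbF.
- move=> lY; have lZ : l \in Z by move: (setU_eqT l full); rewrite (negPf lY).
  rewrite (negPf lY) addn0 (_ : l |: Z = Z); last first.
    by apply/finset.setUidPr; rewrite finset.sub1set.
  rewrite mulrA /nrm mulrA; congr (_ * _).
  by apply: mulr_transfer; rewrite ?sg_sqr // sg_extend_left.
Qed.

End Counting.

(** * Steenrod's terms and their cubical boundary *)

Section Steenrod.
Variable n : nat.
Implicit Types (Y Z : {set 'I_n}) (b : bool) (m : nat).

(** For [b = false] these are the terms of Steenrod's coproduct of degree m - 1, and for [b = true]
    those of its transpose, by [steenrod_swap]. *)
Definition steenrod b m Y Z : bool :=
  [&& Y :|: Z == [set: 'I_n]%SET, #|Y :&: Z| == m &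
    [forall a, (a \notin Y :&: Z) ==>
       ((a \in Y) == b (+) odd (above (Y :&: Z) a))]].

Definition steenrod_table b m Y Z : int := (steenrod b m Y Z)%:R * sg Y Z.

Lemma nrm_steenrod b m Y Z :
  nrm (steenrod_table b m) Y Z = (steenrod b m Y Z)%:R.
Proof. by rewrite /nrm mulrCA sg_sqr mulr1. Qed.

Lemma steenrod_full b m Y Z : steenrod b m Y Z -> Y :|: Z = [set: 'I_n]%SET.
Proof. by case/and3P => /eqP. Qed.

Lemma steenrod_card b m Y Z : steenrod b m Y Z -> #|Y :&: Z| = m.
Proof. by case/and3P => _ /eqP. Qed.

Lemma steenrod_mem b m Y Z a : steenrod b m Y Z -> a \notin Y :&: Z ->
  (a \in Y) = b (+) odd (above (Y :&: Z) a).
Proof. by case/and3P => _ _ /forallP/(_ a)/implyP h /h/eqP. Qed.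

Lemma steenrod_swap b m Y Z : steenrod b m Z Y = steenrod (~~ b) m Y Z.
Proof.
rewrite /steenrod finset.setUC finset.setIC; case: eqP => //= full; congr (_ && _).
apply: eq_forallb => a; case aM: (a \notin _) => //=.
have := setU_eqT a full; move: aM; rewrite inE.
by case: (a \in Y); case: (a \in Z); case: b; case: odd.
Qed.

(** The right-hand side of the coproduct equation in degree [m]; [#|Y|.-1 * #|Z|.-1] is the product
    of dimensions in the sign of T. *)
Definition symmetrized m Y Z : int := steenrod_table false m Y Z +
  (-1) ^+ m * ((-1) ^+ (#|Y|.-1 * #|Z|.-1) * steenrod_table false m Z Y).

Lemma swap_steenrod_table b m Y Z : (0 < #|Y|)%N -> (0 < #|Z|)%N ->
  (-1) ^+ m * ((-1) ^+ (#|Y|.-1 * #|Z|.-1) * steenrod_table b m Z Y) =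
  - steenrod_table (~~ b) m Y Z.
Proof.
move=> Y0 Z0; rewrite /steenrod_table steenrod_swap.
case st: steenrod; last by rewrite !mul0r !mulr0 oppr0.
rewrite !mul1r mulrA -exprD.
by rewrite (sg_swap (steenrod_full st) (steenrod_card st)).
Qed.

Lemma symmetrizedE m Y Z : (0 < #|Y|)%N -> (0 < #|Z|)%N ->
  symmetrized m Y Z = steenrod_table false m Y Z - steenrod_table true m Y Z.
Proof. by move=> Y0 Z0; rewrite /symmetrized swap_steenrod_table. Qed.

Lemma bd_steenrod_full i Y Z : Y :|: Z = [set: 'I_n]%SET ->
  bd (steenrod_table false i.+1) Y Z =
  steenrod_table false i Y Z - steenrod_table true i Y Z.
Proof.
move=> full; have -> : bd (steenrod_table false i.+1) Y Z =
    sg Y Z * (sg Y Z * bd (steenrod_table false i.+1) Y Z).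
  by rewrite mulrA sg_sqr mul1r.
rewrite bd_full // /steenrod_table -mulrBl mulrC; congr (_ * _).
under eq_bigr do rewrite nrm_steenrod.
set M := Y :&: Z.
have cardU l : l \notin M -> #|(l |: Y) :&: (l |: Z)| = #|M|.+1.
  move=> lM; rewrite -finset.setUIr cardsU1 -/M lM //.
have [cM|cM] := eqVneq #|M| i; last first.
  rewrite big1 => [|l lM].
    by rewrite /steenrod -/M (negPf cM) !andbF subrr.
  by rewrite /steenrod cardU // eqSS (negPf cM) andbF mulr0.
(* [g] marks the vertices at which the pair departs from Steenrod's rule. *)
pose g a := (a \in Y) (+) odd (above M a).
(* The vertices [lower 0], ..., [lower n] of the cube with free coordinates
   outside [M] form a monotone path whose edges are the Steenrod terms meeting in
   [M] and one more point, so that the boundary telescopes. *)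
pose lower x := [forall a, (a \notin M) ==> (g a == (a < x)%N)].
have -> : steenrod false i Y Z = lower 0.
  rewrite /steenrod full eqxx -/M cM eqxx /=; apply: eq_forallb => a.
  by rewrite ltn0 /g; case: (a \in Y); case: odd.
have -> : steenrod true i Y Z = lower n.
  rewrite /steenrod full eqxx -/M cM eqxx /=; apply: eq_forallb => a.
  by rewrite ltn_ord /g; case: (a \in Y); case: odd.
rewrite -opprB -(telescope_sumr (fun x => (lower x)%:R)) // big_mkord.
rewrite -sumrN big_mkcond /=; apply: eq_bigr => l _; rewrite opprB.
case: ifPn => [lM|]; last first.
  (* A vertex of the overlap is not a coordinate of this cube, so the path does not move there. *)
  rewrite negbK => lM; rewrite (_ : lower l.+1 = lower l) ?subrr //.
  apply: eq_forallb => a; have [->|al] := eqVneq a l; first by rewrite lM.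
  by rewrite ltnS leq_eqVlt (inj_eq val_inj) (negPf al).
pose rest := [forall a, (a \notin M) && (a != l) ==> (g a == (a < l)%N)].
have -> : steenrod false i.+1 (l |: Y) (l |: Z) = rest.
  rewrite /steenrod cardU // cM eqxx -finset.setUIr -/M.
  rewrite -finset.setUUr full finset.setUT eqxx /=; apply: eq_forallb => a.
  rewrite !inE -/M negb_or andbC; have [//|al] := eqVneq a l; rewrite ?andbF //=.
  rewrite aboveU1 // oddD oddb /g.
  by case: (_ && _) => //=; case: (a \in Y); case: odd; case: ltnP.
(* Consecutive values of [lower] can differ only in the condition at [l]; the conditions that they
   share form [rest], the edge in direction [l]. *)
have restP x : (forall a : 'I_n, a != l -> (a < x)%N = (a < l)%N) ->
    lower x = (g l == (l < x)%N) && rest.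
  move=> ax; apply/forallP/andP => [h|[gl /forallP h] a].
    split; first by have := h l; rewrite lM.
    apply/forallP => a; apply/implyP => /andP[aM al].
    by rewrite -ax //; have := h a; rewrite aM.
  have [->|al] := eqVneq a l; first by rewrite lM.
  by have := h a; rewrite al andbT ax.
rewrite (restP l) // (restP l.+1) => [|a al]; last first.
  by rewrite ltnS leq_eqVlt (inj_eq val_inj) (negPf al).
rewrite ltnn ltnSn -[(-1) ^+ _]signr_odd oddD oddb addbC -/(g l).
by case: (g l) => /=; rewrite ?mulN1r ?mul1r ?sub0r ?subr0.
Qed.

End Steenrod.

(** * Face maps and the equation on coefficients *)

Section Coface.
Variables (p : nat) (k : 'I_p.+2).
Implicit Types (W V Y Z : {set 'I_p.+1}).
Local Notation up W := (fintype.lift k @: W)%SET.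
Local Notation down W := (fintype.lift k @^-1: W)%SET.

Lemma lift_ltn (x y : 'I_p.+1) : (fintype.lift k x < fintype.lift k y)%N = (x < y)%N.
Proof. by rewrite /= /bump; do 2!case: leqP => /=; lia. Qed.

Lemma notin_up W : k \notin up W.
Proof. by apply/imsetP => -[x _ /eqP]; rewrite (negPf (neq_lift _ _)). Qed.

Lemma mem_up W x : (fintype.lift k x \in up W) = (x \in W).
Proof. by rewrite mem_imset //; exact: fintype.lift_inj. Qed.

Lemma down_up W : down (up W) = W.
Proof. by apply/setP => x; rewrite inE mem_up. Qed.

Lemma up_down (W : {set 'I_p.+2}) : k \notin W -> up (down W) = W.
Proof.
move=> kW; apply/setP => x; case: (unliftP k x) => [y ->|->].
  by rewrite mem_up inE.
by rewrite (negPf (notin_up _)) (negPf kW).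
Qed.

Lemma up_setI W V : up W :&: up V = up (W :&: V).
Proof.
apply/setP => x; case: (unliftP k x) => [y ->|->]; rewrite inE ?mem_up ?inE //.
by rewrite !(negPf (notin_up _)).
Qed.

Lemma up_setD W V : up W :\: up V = up (W :\: V).
Proof.
apply/setP => x; case: (unliftP k x) => [y ->|->]; rewrite inE ?mem_up ?inE //.
by rewrite !(negPf (notin_up _)).
Qed.

Lemma card_up W : #|up W| = #|W|.
Proof. exact: (card_imset _ fintype.lift_inj). Qed.

Lemma below_up W (x : 'I_p.+1) : below (up W) (fintype.lift k x) = below W x.
Proof.
rewrite /below big_imset /=; last by move=> ? ? _ _; exact: fintype.lift_inj.
by apply: eq_bigr => w _; rewrite -!lift_ltn.
Qed.

Lemma above_up W (x : 'I_p.+1) : above (up W) (fintype.lift k x) = above W x.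
Proof.
rewrite /above big_imset /=; last by move=> ? ? _ _; exact: fintype.lift_inj.
by apply: eq_bigr => w _; rewrite -!lift_ltn.
Qed.

Lemma inversions_up W V : inversions (up W) (up V) = inversions W V.
Proof.
rewrite /inversions big_imset /=; last by move=> ? ? _ _; exact: fintype.lift_inj.
by apply: eq_bigr => w _; rewrite -below_up.
Qed.

Lemma below_upT : below (up [set: 'I_p.+1]) k = k.
Proof.
rewrite /below big_imset /=; last by move=> ? ? _ _; exact: fintype.lift_inj.
have ltk (x : 'I_p.+1) : (bump k x < k)%N = (x < k)%N.
  by rewrite /bump; case: leqP => /=; lia.
under eq_bigr do rewrite ltk.
rewrite (eq_bigl xpredT) => [|x]; last by rewrite inE.
by apply: sum_ltn; rewrite -ltnS.
Qed.

Lemma card_down (W : {set 'I_p.+2}) : k \notin W -> #|down W| = #|W|.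
Proof. by move=> kW; rewrite -{2}(up_down kW) card_up. Qed.

(** The k vertices preceding [k] are shared out between the overlap and the two sides. This relates
    positions inside the faces to the sign (-1)^k of a face map. *)
Lemma below_full Y Z : Y :|: Z = [set: 'I_p.+1]%SET ->
  nat_of_ord k = (below (up (Y :&: Z)) k + below (up (Y :\: Z)) k +
                  below (up (Z :\: Y)) k)%N.
Proof.
move=> full; rewrite -[LHS]below_upT -full /below.
rewrite !big_imset /=; try by move=> ? ? _ _; exact: fintype.lift_inj.
rewrite (big_setID Y) /= finset.setUK.
have -> : (Y :|: Z) :\: Y = Z :\: Y.
  by apply/setP => x; rewrite !inE; case: (x \in Y).
by rewrite [X in (X + _)%N = _](big_setID Z).
Qed.

(** Inserting the missing vertex on the left, or on the right in [sg_coface_right], yields the same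
    sign, so either boundary term can match the term coming from the k-th face. *)
Lemma sg_coface_left Y Z : Y :|: Z = [set: 'I_p.+1]%SET ->
  (-1) ^+ below (up Y) k * sg (k |: up Y) (up Z) =
  (-1) ^+ (k + #|Y :&: Z|.+1) * sg Y Z.
Proof.
move=> full; have kE := below_full full; have nE := card_full_pair full.
rewrite /sg -!exprD; apply: eq_sign; rewrite /sg_exponent.
have -> : (k |: up Y) :\: up Z = k |: up (Y :\: Z).
  apply/setP => x; case: (unliftP k x) => [y ->|->]; rewrite !inE ?mem_up ?inE.
    by rewrite eq_sym (negPf (neq_lift _ _)).
  by rewrite eqxx !(negPf (notin_up _)).
have -> : up Z :\: (k |: up Y) = up (Z :\: Y).
  apply/setP => x; case: (unliftP k x) => [y ->|->]; rewrite !inE ?mem_up ?inE.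
    by rewrite eq_sym (negPf (neq_lift _ _)).
  by rewrite eqxx !(negPf (notin_up _)).
have -> : (k |: up Y) :&: up Z = up (Y :&: Z).
  apply/setP => x; case: (unliftP k x) => [y ->|->]; rewrite !inE ?mem_up ?inE.
    by rewrite eq_sym (negPf (neq_lift _ _)).
  by rewrite eqxx !(negPf (notin_up _)).
rewrite inversionsU1l ?notin_up // !inversions_up cardsU1 notin_up card_up.
rewrite (below_partition _ (up Z)) up_setI up_setD.
have := card_below_above (notin_up (Y :&: Z)).
have := card_below_above (notin_up (Y :\: Z)).
have := card_below_above (notin_up (Z :\: Y)).
rewrite !card_up; move: kE nE; rewrite mulSn mulnDr muln1.
move: (p.+1 * _)%N => q; lia.
Qed.

Lemma sg_coface_right Y Z : Y :|: Z = [set: 'I_p.+1]%SET ->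
  (-1) ^+ (#|up Y|.+1 + below (up Z) k) * sg (up Y) (k |: up Z) =
  (-1) ^+ (k + #|Y :&: Z|.+1) * sg Y Z.
Proof.
move=> full; have kE := below_full full; have nE := card_full_pair full.
rewrite /sg -!exprD; apply: eq_sign; rewrite /sg_exponent.
have -> : (k |: up Z) :\: up Y = k |: up (Z :\: Y).
  apply/setP => x; case: (unliftP k x) => [y ->|->]; rewrite !inE ?mem_up ?inE.
    by rewrite eq_sym (negPf (neq_lift _ _)).
  by rewrite eqxx !(negPf (notin_up _)).
have -> : up Y :\: (k |: up Z) = up (Y :\: Z).
  apply/setP => x; case: (unliftP k x) => [y ->|->]; rewrite !inE ?mem_up ?inE.
    by rewrite eq_sym (negPf (neq_lift _ _)).
  by rewrite eqxx !(negPf (notin_up _)).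
have -> : up Y :&: (k |: up Z) = up (Y :&: Z).
  apply/setP => x; case: (unliftP k x) => [y ->|->]; rewrite !inE ?mem_up ?inE.
    by rewrite eq_sym (negPf (neq_lift _ _)).
  by rewrite eqxx !(negPf (notin_up _)).
rewrite inversionsU1r ?notin_up // !inversions_up !card_up.
rewrite (below_partition _ (up Y)) up_setI up_setD (finset.setIC Z Y).
have := card_below_above (notin_up (Y :&: Z)).
have := card_below_above (notin_up (Y :\: Z)).
have := card_below_above (notin_up (Z :\: Y)).
have := cardsID Z Y.
rewrite !card_up; move: kE nE; rewrite !mulSn.
move: (p * _)%N => q; lia.
Qed.

Lemma forall_lift (P : pred 'I_p.+2) :
  [forall a, P a] = P k && [forall a, P (fintype.lift k a)].
Proof.
apply/forallP/andP => [h|[Pk /forallP h] a]; first by split=> //; apply/forallP.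
by case: (unliftP k a) => [b ->|->].
Qed.

Lemma full_up Y Z :
  (k |: up Y :|: up Z == [set: 'I_p.+2]%SET) = (Y :|: Z == [set: 'I_p.+1]%SET).
Proof.
apply/eqP/eqP => /setP h; apply/setP => x.
  have := h (fintype.lift k x); rewrite !inE !mem_up.
  by rewrite eq_sym (negPf (neq_lift _ _)).
case: (unliftP k x) => [y ->|->]; last by rewrite !inE eqxx.
by have := h y; rewrite !inE !mem_up eq_sym (negPf (neq_lift _ _)).
Qed.

(** The inserted vertex is outside the overlap, so the parity rule puts it on exactly one side; at
    the other vertices the rule is unchanged, as [above] only counts overlap vertices. *)
Lemma steenrod_coface b m Y Z :
  (steenrod b m (k |: up Y) (up Z) + steenrod b m (up Y) (k |: up Z) =
   steenrod b m Y Z)%N.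
Proof.
rewrite /steenrod finset.setUCA finset.setUA full_up.
have -> : (k |: up Y) :&: up Z = up (Y :&: Z).
  rewrite -up_setI finset.setIUl; apply/finset.setUidPr/fintype.subsetP => x.
  by rewrite !inE => /andP[/eqP ->]; rewrite (negPf (notin_up _)).
have -> : up Y :&: (k |: up Z) = up (Y :&: Z).
  rewrite -up_setI finset.setIUr; apply/finset.setUidPr/fintype.subsetP => x.
  by rewrite !inE andbC => /andP[/eqP ->]; rewrite (negPf (notin_up _)).
rewrite card_up; case: eqP => //= _; case: eqP => //= _.
rewrite !forall_lift !notin_up !inE eqxx (negPf (notin_up _)) /=.
have eqf (V : {set 'I_p.+2}) : (forall a, (fintype.lift k a \in V) = (a \in Y)) ->
  [forall a, (fintype.lift k a \notin up (Y :&: Z)) ==>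
     ((fintype.lift k a \in V) == b (+) odd (above (up (Y :&: Z)) (fintype.lift k a)))] =
  [forall a, (a \notin Y :&: Z) ==>
     ((a \in Y) == b (+) odd (above (Y :&: Z) a))].
  by move=> h; apply: eq_forallb => a; rewrite h mem_up above_up.
rewrite !eqf // => [|a|a]; rewrite ?mem_up //; last first.
  by rewrite !inE mem_up eq_sym (negPf (neq_lift _ _)).
by case: (b (+) _); case: [forall _, _].
Qed.

End Coface.

(** The coefficients of D composed with the boundary, see [coface_formula]: a pair comes from the
    k-th face when neither member contains [k], and a 0-simplex has boundary 0. *)
Definition cof (c : coefficients) (p : nat) :
    {set 'I_p.+1} -> {set 'I_p.+1} -> int :=
  match p return {set 'I_p.+1} -> {set 'I_p.+1} -> int with
  | 0 => fun _ _ => 0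
  | q.+1 => fun Y Z => \sum_(k | (k \notin Y) && (k \notin Z))
      (-1) ^+ k * c q (fintype.lift k @^-1: Y)%SET (fintype.lift k @^-1: Z)%SET
  end.

Definition coproduct_table (i : nat) (c : coefficients) : Prop :=
  forall p (Y Z : {set 'I_p.+1}), (0 < #|Y|)%N -> (0 < #|Z|)%N ->
    bd (c p) Y Z - (-1) ^+ i * cof c Y Z = symmetrized i Y Z.

Definition vanishes_off_full n (e : {set 'I_n} -> {set 'I_n} -> int) : Prop :=
  forall Y Z : {set 'I_n}, (0 < #|Y|)%N -> (0 < #|Z|)%N ->
    Y :|: Z != [set: 'I_n]%SET -> e Y Z = 0.

Lemma not_full n (Y Z : {set 'I_n}) k : k \notin Y -> k \notin Z ->
  Y :|: Z != [set: 'I_n]%SET.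
Proof.
by move=> kY kZ; apply/eqP => /(setU_eqT k); rewrite (negPf kY) (negPf kZ).
Qed.

Lemma not_fullP n (Y Z : {set 'I_n}) : Y :|: Z != [set: 'I_n]%SET ->
  exists k, k \notin Y /\ k \notin Z.
Proof.
rewrite -finset.subTset => /fintype.subsetPn[k _].
by rewrite inE negb_or => /andP[]; exists k.
Qed.

Lemma steenrod_table_off_full n b m (Y Z : {set 'I_n}) :
  Y :|: Z != [set: 'I_n]%SET -> steenrod_table b m Y Z = 0.
Proof.
move=> /eqP nf; rewrite /steenrod_table.
by case st: steenrod; rewrite ?mul0r //; have := steenrod_full st.
Qed.

(** Adding any vertex other than [k] leaves [k] uncovered, so only the two terms inserting [k] can
    survive. *)
Lemma bd_one_missing n (e : {set 'I_n} -> {set 'I_n} -> int)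
    (Y Z : {set 'I_n}) k :
    vanishes_off_full e -> (0 < #|Y|)%N -> (0 < #|Z|)%N ->
    k \notin Y -> k \notin Z ->
  bd e Y Z = (-1) ^+ below Y k * e (k |: Y) Z +
             (-1) ^+ (#|Y|.+1 + below Z k) * e Y (k |: Z).
Proof.
move=> e0 Y0 Z0 kY kZ; have cU (W : {set 'I_n}) y : (0 < #|W|)%N -> (0 < #|y |: W|)%N.
  by move=> W0; rewrite (leq_trans W0) // subset_leq_card // finset.subsetUr.
rewrite /bd (bigD1 k) // [in X in _ + X](bigD1 k) //=.
rewrite big1 ?addr0 => [|y /andP[_ yk]]; last first.
  by rewrite e0 ?mulr0 ?cU // (not_full (k := k)) // !inE eq_sym (negPf yk).
rewrite big1 ?addr0 // => y /andP[_ yk].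
by rewrite e0 ?mulr0 ?cU // (not_full (k := k)) // !inE eq_sym (negPf yk).
Qed.

Lemma cof_one_missing (c : coefficients) q (Y Z : {set 'I_q.+2}) k :
    vanishes_off_full (c q) -> (0 < #|Y|)%N -> (0 < #|Z|)%N ->
    k \notin Y -> k \notin Z ->
  cof c Y Z =
    (-1) ^+ k * c q (fintype.lift k @^-1: Y)%SET (fintype.lift k @^-1: Z)%SET.
Proof.
move=> c0 Y0 Z0 kY kZ; rewrite /= (bigD1 k) ?kY //= big1 ?addr0 //.
move=> k' /andP[/andP[kY' kZ'] kk']; rewrite c0 ?mulr0 ?card_down //.
case: (unliftP k' k) kk' => [y ky _|->]; last by rewrite eqxx.
by apply: (not_full (k := y)); rewrite inE -ky.
Qed.

Lemma cof_full (c : coefficients) p (Y Z : {set 'I_p.+1}) :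
  Y :|: Z = [set: 'I_p.+1]%SET -> cof c Y Z = 0.
Proof.
case: p Y Z => [//|p] Y Z full; apply: big1 => k /andP[kY kZ].
by move: (not_full kY kZ); rewrite full eqxx.
Qed.

Lemma symmetrized_off_full n m (Y Z : {set 'I_n}) :
    (0 < #|Y|)%N -> (0 < #|Z|)%N -> Y :|: Z != [set: 'I_n]%SET ->
  symmetrized m Y Z = 0.
Proof.
by move=> Y0 Z0 nf; rewrite symmetrizedE // !steenrod_table_off_full ?subrr.
Qed.

Definition steenrod_coefficients (b : bool) (m : nat) : coefficients :=
  fun p => @steenrod_table p.+1 b m.
Arguments steenrod_coefficients : clear implicits.

(** On covering pairs there is no coface term and the boundary telescopes. On the others the
    right-hand side is 0, and by [steenrod_coface] the boundary terms restoring a missing vertex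
    balance the coface term. *)
Lemma steenrod_coproduct_table i :
  coproduct_table i (steenrod_coefficients false i.+1).
Proof.
move=> p Y Z Y0 Z0; have [full|nf] := eqVneq (Y :|: Z) [set: 'I_p.+1]%SET.
  by rewrite cof_full // mulr0 subr0 bd_steenrod_full // symmetrizedE.
rewrite symmetrized_off_full //; have [k [kY kZ]] := not_fullP nf.
case: p Y Z k Y0 Z0 nf kY kZ => [|p] Y Z k Y0 Z0 nf kY kZ.
  by case/card_gt0P: Y0 => x; rewrite (ord1 x) -(ord1 k) (negPf kY).
have van q : vanishes_off_full (steenrod_coefficients false i.+1 q).
  by move=> Y1 Z1 _ _; exact: steenrod_table_off_full.
rewrite (bd_one_missing (van _) _ _ kY kZ) // (cof_one_missing (van _) _ _ kY kZ) //.
have := steenrod_coface k false i.+1 (fintype.lift k @^-1: Y)%SET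
  (fintype.lift k @^-1: Z)%SET.
have := sg_coface_left k (Y := fintype.lift k @^-1: Y)
  (Z := fintype.lift k @^-1: Z).
have := sg_coface_right k (Y := fintype.lift k @^-1: Y)
  (Z := fintype.lift k @^-1: Z).
rewrite !up_down // /steenrod_coefficients /steenrod_table.
move: (fintype.lift k @^-1: Y)%SET (fintype.lift k @^-1: Z)%SET => Y' Z' sr sl.
case st: (steenrod _ _ Y' Z'); last first.
  by case: steenrod => //; case: steenrod => // _; rewrite !mul0r !mulr0 addr0 subr0.
have full := steenrod_full st; have cM := steenrod_card st.
move: (sr full) (sl full); rewrite cM.
have -> : (-1) ^+ (k + i.+2) = (-1) ^+ (i + k) :> int by apply: eq_sign; lia.
rewrite mul1r mulrA -exprD.
case: steenrod; case: steenrod => // er el _.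
  by rewrite mul0r mulr0 addr0 mul1r el subrr.
by rewrite mul0r mulr0 add0r mul1r er subrr.
Qed.

(** * Projecting cubical cycles to a set of directions *)

Section Cycles.
Variable n : nat.
Implicit Types (A L : {set 'I_n}).

(** Toggling [l] pairs the sets containing it with those that do not; paired terms have the same
    value of [G] and opposite signs. *)
Lemma toggle_sum0 (P : pred {set 'I_n}) (G : {set 'I_n} -> int) l :
    (forall A, P (l |: A) = P (A :\ l)) ->
  \sum_(A | P A) (-1) ^+ (l \in A) * G (A :\ l) = 0.
Proof.
move=> Pl; rewrite (bigID (fun A : {set 'I_n} => l \in A)) /=.
rewrite [X in _ + X](reindex_onto (fun A => A :\ l) (fun A => l |: A)) /=; last first.
  by move=> A /andP[_ lA]; rewrite finset.setU1K.
rewrite [X in _ + X](eq_bigl (fun A => P A && (l \in A))); last first.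
  move=> A; rewrite !inE eqxx andbT.
  case lA: (l \in A).
    rewrite finset.setD1K // eqxx -Pl.
    by rewrite (finset.setUidPr _) ?finset.sub1set ?lA ?andbT.
  by rewrite andbF; apply/negbTE/negP => /andP[_ /eqP/setP/(_ l)]; rewrite !inE eqxx lA.
rewrite -big_split big1 //= => A /andP[_ lA].
rewrite lA !inE eqxx /= expr1 expr0 mul1r mulN1r.
have -> : A :\ l :\ l = A :\ l by apply/setP => x; rewrite !inE; case: eqP.
exact: addNr.
Qed.

Lemma pairU L A : (L :|: A) :|: ~: A = [set: 'I_n]%SET.
Proof. by apply/setP => x; rewrite !inE; case: (x \in A); rewrite ?orbT. Qed.

Lemma pairI L A : A \subset ~: L -> (L :|: A) :&: ~: A = L.
Proof.
move=> /fintype.subsetP h; apply/setP => x; have := h x; rewrite !inE.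
by case: (x \in A) => /=; [case: (x \in L) => // /(_ isT)|rewrite orbF andbT].
Qed.

(** Add the equations at all pairs of overlap [L :\ l] that have [l] on the right only. In any
    direction other than [l] each edge is met from both ends and cancels; in direction [l] each
    coefficient of overlap [L] is left once, all with the same sign. *)
Lemma cycle_sum0 (h : {set 'I_n} -> {set 'I_n} -> int) L l : l \in L ->
    (forall A : {set 'I_n}, l \notin A -> A \subset ~: (L :\ l) ->
       bd h ((L :\ l) :|: A) (~: A) = 0) ->
  \sum_(A : {set 'I_n} | A \subset ~: L) nrm h (L :|: A) (~: A) = 0.
Proof.
move=> lL h0; set M := L :\ l.
pose P := [pred A : {set 'I_n} | (A \subset ~: M) && (l \notin A)].
have lM : l \notin M by rewrite !inE eqxx.
have : \sum_(A | P A) sg (M :|: A) (~: A) * bd h (M :|: A) (~: A) = 0.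
  by apply: big1 => A /andP[AM lA]; rewrite h0 ?mulr0.
under eq_bigr => A /andP[AM lA].
  rewrite (bd_full _ (pairU M A)) (pairI AM).
  under eq_bigr => l' l'M.
    have -> : l' |: (M :|: A) = (l' |: M) :|: (A :\ l').
      by apply/setP => x; rewrite !inE; case: eqP.
    have -> : l' |: ~: A = ~: (A :\ l').
      by apply/setP => x; rewrite !inE; case: eqP => //= ->.
    have -> : (l' \in M :|: A) = (l' \in A) by rewrite inE (negPf l'M).
    rewrite exprD -mulrA.
    over.
  over.
rewrite exchange_big /= (bigD1 l) //= [X in _ + X]big1 => [|l' /andP[l'M l'l]].
  rewrite addr0 -big_distrr /= => /eqP; rewrite mulf_eq0 signr_eq0 /= => /eqP.
  move=> e; rewrite -[RHS]e; apply: eq_big => [A|A].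
    apply/idP/andP => [/fintype.subsetP AL|[/fintype.subsetP AM lA]].
      split; last by apply/negP => /AL; rewrite !inE lL.
      by apply/fintype.subsetP => x /AL; rewrite !inE negb_and orbC => ->.
    apply/fintype.subsetP => x xA; have := AM x xA; rewrite !inE.
    by case: eqP => // xl; rewrite xl (negPf lA) in xA.
  move=> AL; have lA : l \notin A.
    by apply/negP => /(fintype.subsetP AL); rewrite inE lL.
  rewrite (negPf lA) mul1r finset.setD1K //.
  by have -> : A :\ l = A; first by apply/finset.setDidPl; rewrite disjoint_sym disjoints1.
rewrite -big_distrr /= (toggle_sum0 (P := P)
  (fun A => nrm h (l' |: M :|: A) (~: A))) ?mulr0 // => A.
rewrite /P /= !inE eq_sym (negPf l'l) /=; congr (_ && _).
rewrite finset.subUset finset.sub1set inE l'M /=.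
apply/fintype.subsetP/fintype.subsetP => s x.
  by case/finset.setD1P => _ /s.
move=> xA; have [->|xl] := eqVneq x l'; first by rewrite inE.
by apply: s; rewrite !inE xl.
Qed.

End Cycles.

(** * Uniqueness of minimal solutions *)

Lemma card_gt0U1 n (W : {set 'I_n}) y : (0 < #|y |: W|)%N.
Proof. by apply/card_gt0P; exists y; rewrite !inE eqxx. Qed.

(* Summing the equation over the pairs ({y}, Z), with Z missing only one vertex,
   amounts to applying the counit to the left factor. *)
Lemma augmentation_eq0 (h : coefficients) :
    (forall p (Y Z : {set 'I_p.+1}), (0 < #|Y|)%N -> (0 < #|Z|)%N ->
       bd (h p) Y Z = cof h Y Z) ->
    h 0%N [set: 'I_1]%SET [set: 'I_1]%SET = 0 ->
  forall p, \sum_(y : 'I_p.+1) h p [set y]%SET [set: 'I_p.+1]%SET = 0.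
Proof.
move=> h_eq h0; elim=> [|p IH].
  rewrite big_ord1 (_ : [set ord0]%SET = [set: 'I_1]%SET) //.
  by apply/setP => x; rewrite !inE (ord1 x).
set Z := (~: [set ord0 : 'I_p.+2])%SET.
have ZU : ord0 |: Z = [set: 'I_p.+2]%SET by rewrite finset.setUCr.
have Z0 : (0 < #|Z|)%N by apply/card_gt0P; exists (fintype.lift ord0 ord0); rewrite !inE.
have bdE (y : 'I_p.+2) : bd (h p.+1) [set y]%SET Z =
    \sum_(x | x != y) (-1) ^+ (y < x)%N * h p.+1 (x |: [set y])%SET Z +
    h p.+1 [set y]%SET [set: 'I_p.+2]%SET.
  rewrite /bd; congr (_ + _).
    apply: eq_big => [x|x _]; first by rewrite !inE.
    by rewrite /below big_set1.
  rewrite (eq_bigl (pred1 ord0)) => [|x]; last by rewrite !inE negbK.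
  rewrite big_pred1_eq ZU cards1 /below big1 ?addn0 ?sqrrN ?expr1n ?mul1r //.
have cofE (y : 'I_p.+1) : cof h [set fintype.lift ord0 y]%SET Z =
    h p [set y]%SET [set: 'I_p.+1]%SET.
  rewrite /= (eq_bigl (pred1 ord0)) => [|x]; last first.
    rewrite !inE negbK /=; case: (eqVneq x ord0) => [->|]; last by rewrite andbF.
    by rewrite andbT (negPf (neq_lift _ _)).
  rewrite big_pred1_eq expr0 mul1r; congr (h p _ _).
    by apply/setP => x; rewrite !inE (inj_eq fintype.lift_inj).
  by apply/setP => x; rewrite !inE eq_sym neq_lift.
have cof0 : cof h [set ord0]%SET Z = 0.
  apply: big1 => x; rewrite !inE negbK => /andP[/negPf ->] //.
have : \sum_(y : 'I_p.+2) bd (h p.+1) [set y]%SET Z = 0.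
  rewrite (eq_bigr (fun y => cof h [set y]%SET Z)) => [|y _]; last first.
    by rewrite h_eq ?cards1.
  rewrite big_ord_recl cof0 add0r -[RHS]IH.
  by apply: eq_bigr => y _; rewrite cofE.
under eq_bigr do rewrite bdE; rewrite big_split /=.
set X := (X in X + _ = 0 -> _); suff -> : X = 0 by rewrite add0r.
(* The edge joining x and y is counted from both ends, with opposite signs. *)
have : X = - X; last by lia.
rewrite {1}/X (exchange_big_dep xpredT) //= -sumrN; apply: eq_bigr => x _.
rewrite -sumrN; apply: eq_big => [y|y]; first by rewrite eq_sym.
move=> xy; rewrite (finset.setUC [set x]%SET) -mulNr; congr (_ * _).
by case: ltngtP xy => //= /val_inj ->; rewrite eqxx.
Qed.

Lemma steenrod_table_point :
  steenrod_table false 1 [set: 'I_1]%SET [set: 'I_1]%SET = 1.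
Proof.
rewrite /steenrod_table /steenrod finset.setUid finset.setIid eqxx cardsT card_ord /=.
have -> : [forall a : 'I_1, (a \notin [set: 'I_1]%SET) ==>
    ((a \in [set: 'I_1]%SET) == odd (above [set: 'I_1]%SET a))].
  by apply/forallP => a; rewrite inE.
rewrite mul1r /sg /sg_exponent finset.setDv finset.setIid cards0 muln0 addn0.
rewrite /inversions big_set0 add0n big1 ?expr0 // => b _.
by rewrite /below big1 // => a _; rewrite (ord1 a) (ord1 b).
Qed.

Section Comparison.
Variables (i : nat) (c : coefficients).
Arguments c : clear implicits.
Hypothesis c_eq : coproduct_table i c.
Hypothesis c_norm : i = 0%N -> c 0%N [set: 'I_1]%SET [set: 'I_1]%SET = 1.

Let d := steenrod_coefficients false i.+1.
Arguments d : clear implicits.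
Let h : coefficients := fun p Y Z => c p Y Z - d p Y Z.
Arguments h : clear implicits.

Lemma difference_eq p (Y Z : {set 'I_p.+1}) : (0 < #|Y|)%N -> (0 < #|Z|)%N ->
  bd (h p) Y Z = (-1) ^+ i * cof h Y Z.
Proof.
move=> Y0 Z0; have := c_eq Y0 Z0; rewrite -(steenrod_coproduct_table _ Y0 Z0).
have -> : bd (h p) Y Z = bd (c p) Y Z - bd (d p) Y Z.
  rewrite /bd opprD addrACA -!sumrB.
  by congr (_ + _); apply: eq_bigr => y _; rewrite mulrBr.
have -> : cof h Y Z = cof c Y Z - cof d Y Z.
  case: p Y Z Y0 Z0 => [|p] Y Z _ _; first by rewrite subr0.
  by rewrite /= -sumrB; apply: eq_bigr => k _; rewrite mulrBr.
by move=> e; apply/eqP; rewrite mulrBr -subr_eq0; apply/eqP; move: e; rewrite -/d; lia.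
Qed.

Lemma difference_sum0 p (L : {set 'I_p.+1}) : #|L| = i.+1 ->
  \sum_(A : {set 'I_p.+1} | A \subset ~: L) nrm (h p) (L :|: A) (~: A) = 0.
Proof.
move=> cL; have /card_gt0P[l lL] : (0 < #|L|)%N by rewrite cL.
apply: (cycle_sum0 lL) => A lA AL.
have A0 : (0 < #|~: A|)%N by apply/card_gt0P; exists l; rewrite inE.
(* The equation concerns non-empty faces. The left face is empty only when i = 0 and [A] is empty;
   then the required sum is given by [augmentation_eq0], and this is where the normalisation on
   0-simplices enters. *)
have [/eqP|Y0] := posnP #|L :\ l :|: A|; last first.
  by rewrite difference_eq // cof_full ?mulr0 // pairU.
rewrite cards_eq0 => /eqP Y0; have AE : A = finset.set0.
  by apply/eqP; rewrite -finset.subset0 -Y0 finset.subsetUr.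
have i0 : i = 0%N.
  have : L :\ l \subset finset.set0 by rewrite -Y0 finset.subsetUl.
  by rewrite finset.subset0 -cards_eq0; have := cardsD1 l L; rewrite lL cL; lia.
rewrite Y0 AE finset.setC0 /bd [X in _ + X]big_pred0 => [|z]; last by rewrite inE.
rewrite addr0 (eq_bigl xpredT) => [|y]; last by rewrite inE.
rewrite -[RHS](augmentation_eq0 (h := h) _ _ p).
- by apply: eq_bigr => y _; rewrite /below big_set0 expr0 mul1r finset.setU0.
- by move=> q Y Z Y1 Z1; rewrite difference_eq // i0 expr0 mul1r.
- by rewrite /h c_norm // /d i0 /steenrod_coefficients steenrod_table_point subrr.
Qed.

Lemma steenrod_pair n (L A : {set 'I_n}) m : #|L| = m -> A \subset ~: L ->
  steenrod false m (L :|: A) (~: A) =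
  (A == [set a | (a \notin L) && odd (above L a)]%SET).
Proof.
move=> cL AL; rewrite /steenrod pairU pairI // cL !eqxx /=.
have AnL a : a \in A -> a \notin L by move/(fintype.subsetP AL); rewrite inE.
apply/forallP/eqP => [st|-> a].
  apply/setP => a; rewrite inE; have := st a; have := AnL a.
  rewrite inE; case: (a \in L) => /=; last by move=> _ /eqP.
  by case: (a \in A) => // /(_ isT).
by apply/implyP => aL; rewrite !inE (negPf aL).
Qed.

(** The difference with Steenrod's table contributes 0, and that table has a single term of overlap
    [L], with normalised coefficient 1. *)
Lemma parallel_sum p (L : {set 'I_p.+1}) : #|L| = i.+1 ->
  \sum_(A : {set 'I_p.+1} | A \subset ~: L) nrm (c p) (L :|: A) (~: A) = 1.
Proof.
move=> cL; have := difference_sum0 cL.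
have -> : \sum_(A : {set 'I_p.+1} | A \subset ~: L) nrm (h p) (L :|: A) (~: A) =
    \sum_(A : {set 'I_p.+1} | A \subset ~: L) nrm (c p) (L :|: A) (~: A) -
    \sum_(A : {set 'I_p.+1} | A \subset ~: L) nrm (d p) (L :|: A) (~: A).
  by rewrite -sumrB; apply: eq_bigr => A _; rewrite /nrm mulrBr.
move=> /eqP; rewrite subr_eq0 => /eqP ->.
under eq_bigr => A AL do rewrite /d nrm_steenrod steenrod_pair //.
set A0 := [set a | _]%SET; rewrite (bigD1 A0) /=; last first.
  by apply/fintype.subsetP => a; rewrite !inE => /andP[].
by rewrite eqxx big1 ?addr0 // => A /andP[_ /negPf ->].
Qed.

Hypothesis c_min : forall p,
  (nterms c p <= #|[set L : {set 'I_p.+1} | #|L| == i.+1]%SET|)%N.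

Lemma parallel_exists p (L : {set 'I_p.+1}) : #|L| = i.+1 ->
  exists YZ : {set 'I_p.+1} * {set 'I_p.+1},
    [/\ YZ.1 :|: YZ.2 = [set: 'I_p.+1]%SET, YZ.1 :&: YZ.2 = L & c p YZ.1 YZ.2 != 0].
Proof.
move=> cL; have := parallel_sum cL.
have [/existsP[A /andP[AL cA] _]|/existsPn h0] := boolP
    [exists A : {set 'I_p.+1}, (A \subset ~: L) && (c p (L :|: A) (~: A) != 0)].
  by exists (L :|: A, ~: A); rewrite /= pairU pairI.
rewrite big1 // => A AL; have := h0 A; rewrite AL /= negbK => /eqP.
by rewrite /nrm => ->; rewrite mulr0.
Qed.

Definition support p := [set YZ : {set 'I_p.+1} * {set 'I_p.+1} |
  [&& (0 < #|YZ.1|)%N, (0 < #|YZ.2|)%N & c p YZ.1 YZ.2 != 0]]%SET.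

Definition full_support p := [set YZ in support p |
  (YZ.1 :|: YZ.2 == [set: 'I_p.+1]%SET) && (#|YZ.1 :&: YZ.2| == i.+1)]%SET.

(** Taking overlaps maps [full_support] onto the sets of size i + 1, while minimality bounds the
    whole support by their number. All the inequalities between these cardinals are thus
    equalities. *)
Lemma full_supportP p : full_support p = support p /\
  {in support p &, injective (fun YZ => YZ.1 :&: YZ.2)}.
Proof.
pose f (YZ : {set 'I_p.+1} * {set 'I_p.+1}) := YZ.1 :&: YZ.2.
have sub : full_support p \subset support p.
  by apply/fintype.subsetP => YZ; rewrite inE => /andP[].
have Lsub : [set L : {set 'I_p.+1} | #|L| == i.+1]%SET \subset f @: full_support p.
  apply/fintype.subsetP => L; rewrite inE => /eqP cL.
  have [[Y Z] /= [full YZL cYZ]] := parallel_exists cL.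
  apply/imsetP; exists (Y, Z); last by rewrite /f /= YZL.
  rewrite !inE /= full eqxx YZL cL eqxx cYZ !andbT.
  have L0 : (0 < #|L|)%N by rewrite cL.
  rewrite !(leq_trans L0) // -YZL subset_leq_card //.
    exact: finset.subsetIr.
  exact: finset.subsetIl.
have c1 := subset_leq_card Lsub.
have c2 : (#|f @: full_support p| <= #|full_support p|)%N by exact: leq_imset_card.
have c3 := subset_leq_card sub; have c4 := c_min p.
have cs : nterms c p = #|support p| by [].
have E : full_support p = support p.
  by apply/eqP; rewrite eqEcard sub /= -cs (leq_trans c4) // (leq_trans c1).
split=> //; rewrite -E; apply/imset_injP; rewrite -/f.
by rewrite eqn_leq c2 (leq_trans c3) // -cs (leq_trans c4).
Qed.

Lemma support_full p (Y Z : {set 'I_p.+1}) : (0 < #|Y|)%N -> (0 < #|Z|)%N ->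
  c p Y Z != 0 -> Y :|: Z = [set: 'I_p.+1]%SET /\ #|Y :&: Z| = i.+1.
Proof.
move=> Y0 Z0 cYZ; have [E _] := full_supportP p.
have : (Y, Z) \in support p by rewrite inE /= Y0 Z0.
by rewrite -E inE /= => /andP[_ /andP[/eqP -> /eqP ->]].
Qed.

Lemma support_inj p (Y Z Y' Z' : {set 'I_p.+1}) :
    (0 < #|Y :&: Z|)%N -> Y :&: Z = Y' :&: Z' -> c p Y Z != 0 ->
  c p Y' Z' != 0 -> Y = Y' /\ Z = Z'.
Proof.
have mem (U V : {set 'I_p.+1}) : (0 < #|U :&: V|)%N -> c p U V != 0 ->
    (U, V) \in support p.
  move=> UV0 cUV; rewrite inE /= cUV andbT !(leq_trans UV0) // subset_leq_card //.
    exact: finset.subsetIr.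
  exact: finset.subsetIl.
move=> L0 e cYZ cYZ'; have [_ inj] := full_supportP p.
have [] // : (Y, Z) = (Y', Z').
by apply: inj; rewrite ?mem // -e.
Qed.

(** By [support_inj] a non-zero term is alone in the sum of [parallel_sum], so its normalised
    coefficient is 1. *)
Lemma nrm_support p (Y Z : {set 'I_p.+1}) : (0 < #|Y :&: Z|)%N ->
  nrm (c p) Y Z = (c p Y Z != 0)%:R.
Proof.
move=> L0; have [cYZ|/= cYZ] := eqVneq (c p Y Z) 0; first by rewrite /nrm cYZ mulr0.
have Y0 : (0 < #|Y|)%N by rewrite (leq_trans L0) // subset_leq_card // finset.subsetIl.
have Z0 : (0 < #|Z|)%N by rewrite (leq_trans L0) // subset_leq_card // finset.subsetIr.
have [full cL] := support_full Y0 Z0 cYZ.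
have AE : ~: (~: Z) = Z by rewrite finset.setCK.
have YE : (Y :&: Z) :|: ~: Z = Y.
  apply/setP => x; rewrite !inE; have := setU_eqT x full.
  by case: (x \in Y); case: (x \in Z).
have := parallel_sum cL; rewrite (bigD1 (~: Z)) /=; last first.
  by rewrite finset.setCS finset.subsetIr.
rewrite YE AE big1 ?addr0 // => A /andP[AL AZ]; apply/eqP; rewrite nrm_eq0.
apply/negPn/negP => cA; move/eqP: AZ; apply.
have e : Y :&: Z = (Y :&: Z :|: A) :&: ~: A by rewrite pairI.
by have [_ ->] := support_inj L0 e cYZ cA; rewrite finset.setCK.
Qed.

Lemma co_singleton_pair n (Y Z : {set 'I_n}) a : Y :|: Z = [set: 'I_n]%SET ->
    Y :&: Z = ~: [set a]%SET ->
  Y = [set: 'I_n]%SET /\ Z = ~: [set a]%SET \/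
  Y = ~: [set a]%SET /\ Z = [set: 'I_n]%SET.
Proof.
move=> full e.
have eP x : (x \in Y) && (x \in Z) = (x != a).
  by have := congr1 (fun W : {set 'I_n} => x \in W) e; rewrite !inE.
have allT (W : {set 'I_n}) : a \in W -> (forall x, x != a -> x \in W) ->
    W = [set: 'I_n]%SET.
  by move=> aW hW; apply/setP => x; rewrite inE; have [->|/hW] := eqVneq x a.
have allC (W : {set 'I_n}) : a \notin W -> (forall x, x != a -> x \in W) ->
    W = ~: [set a]%SET.
  move=> aW hW; apply/setP => x; rewrite !inE.
  by have [->|/hW] := eqVneq x a; first exact: negbTE.
have inY x : x != a -> x \in Y by rewrite -eP => /andP[].
have inZ x : x != a -> x \in Z by rewrite -eP => /andP[].
have := eP a; have := setU_eqT a full; rewrite eqxx /=.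
have [aY|aY] := boolP (a \in Y) => /= [_ /negbT aZ|aZ _].
  by left; split; [exact: allT|exact: allC].
by right; split; [exact: allC|exact: allT].
Qed.

(** In dimension i + 1 an overlap of size i + 1 omits a single vertex [a], and the only choice is
    which of the two factors contains [a]. *)
Let top (a : 'I_i.+2) : {set 'I_i.+2} := ~: [set a]%SET.
Let left_full a := c i.+1 [set: 'I_i.+2]%SET (top a) != 0.
Let right_full a := c i.+1 (top a) [set: 'I_i.+2]%SET != 0.

Lemma card_top a : #|top a| = i.+1.
Proof. by rewrite /top cardsC1 card_ord. Qed.

Lemma left_fullN a : right_full a = ~~ left_full a.
Proof.
have [[Y Z] /= [full YZ cYZ]] := parallel_exists (card_top a).
have [La|La] := boolP (left_full a); last first.
  have [[YE ZE]|[YE ZE]] := co_singleton_pair full YZ; rewrite YE ZE in cYZ => //.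
  by rewrite /left_full /top cYZ in La.
case Ra: (right_full a) => //=; exfalso.
have e : [set: 'I_i.+2]%SET :&: top a = top a :&: [set: 'I_i.+2]%SET.
  by rewrite finset.setIC.
have T0 : (0 < #|[set: 'I_i.+2]%SET :&: top a|)%N by rewrite finset.setTI card_top.
by have [/setP/(_ a) + _] := support_inj T0 e La Ra; rewrite !inE eqxx.
Qed.

Lemma steenrod_left b a : steenrod b i.+1 [set: 'I_i.+2]%SET (top a) =
  (b (+) odd (above (top a) a)).
Proof.
rewrite /steenrod finset.setTU eqxx finset.setTI card_top eqxx /=.
apply/forallP/idP => [/(_ a)|st_a x].
  by rewrite !inE eqxx /= => /eqP <-.
by rewrite !inE negbK; apply/implyP => /eqP ->; rewrite eq_sym; apply/eqP.
Qed.

Lemma steenrod_right b a : steenrod b i.+1 (top a) [set: 'I_i.+2]%SET =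
  ~~ (b (+) odd (above (top a) a)).
Proof. by rewrite steenrod_swap steenrod_left -addNb. Qed.

(** The pair [(top a', top a)] overlaps in i vertices, and the boundary of the difference there has
    two terms: restoring [a] on the right gives overlap [top a'], and restoring [a'] on the left
    gives overlap [top a]. Their sum is 0, which ties the two choices together. *)
Lemma left_full_const a a' :
  left_full a (+) odd (above (top a) a) = left_full a' (+) odd (above (top a') a').
Proof.
have [->//|aa'] := eqVneq a a'.
have full : top a' :|: top a = [set: 'I_i.+2]%SET.
  apply/setP => x; rewrite !inE; have [->|//] := eqVneq x a'.
  by rewrite eq_sym aa'.
have T0 x : (0 < #|top x|)%N by rewrite card_top.
have := bd_full (h i.+1) full.
rewrite difference_eq // cof_full // !mulr0.
have inM x : (x \notin top a' :&: top a) = (x == a) || (x == a').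
  by rewrite !inE negb_and !negbK orbC.
rewrite (eq_bigl _ _ inM) (bigD1 a) ?eqxx //= (bigD1 a') /=; last first.
  by rewrite eqxx orbT eq_sym.
rewrite big1 ?addr0 => [|x]; last by case: eqP => //= _; case: eqP.
have UT x : x |: top x = [set: 'I_i.+2]%SET by rewrite /top finset.setUCr.
have Uid x y : x != y -> x |: top y = top y.
  by move=> xy; apply/finset.setUidPr; rewrite finset.sub1set !inE.
rewrite !UT !Uid // 1?eq_sym // /h.
have nh Y Z : (0 < #|Y :&: Z|)%N -> nrm (h i.+1) Y Z =
    (c i.+1 Y Z != 0)%:R - (steenrod false i.+1 Y Z)%:R.
  by move=> YZ0; rewrite -nrm_support // -nrm_steenrod /nrm mulrBr.
rewrite !nh ?finset.setTI ?finset.setIT // steenrod_left steenrod_right.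
rewrite -/(right_full a') -/(left_full a) left_fullN !addFb.
rewrite -[(-1) ^+ (above _ a + _)]signr_odd -[(-1) ^+ (above _ a' + _)]signr_odd.
(* Whatever the two signs, one deviation from Steenrod vanishes if and only if the other does, so no
   further parity is needed. *)
move: (left_full a) (left_full a') (odd (above (top a) a)) (odd (above (top a') a')).
by move: (odd _) (odd _) => [] [] [] [] [] [].
Qed.

(** By [left_full_const] the bit [b0] is the same at every vertex: it is [false] if the choices in
    dimension i + 1 are Steenrod's and [true] if they are the transposed ones. *)
Let a0 : 'I_i.+2 := ord0.
Let b0 : bool := left_full a0 (+) odd (above (top a0) a0).

(** Induction on the dimension. To locate a vertex [a] outside the overlap, delete another such
    vertex [k]: the equation at the resulting pair produces a term on the face opposite [k], with
    [a] on the same side. *)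
Lemma support_steenrod p (Y Z : {set 'I_p.+1}) : (0 < #|Y|)%N -> (0 < #|Z|)%N ->
  c p Y Z != 0 -> steenrod b0 i.+1 Y Z.
Proof.
elim: p Y Z => [|p IH] Y Z Y0 Z0 cYZ.
  have [full cM] := support_full Y0 Z0 cYZ.
  rewrite /steenrod full cM !eqxx /=; apply/forallP => a; apply/implyP.
  have := cardsC (Y :&: Z); rewrite card_ord cM => cC aM.
  suff : (0 < #|~: (Y :&: Z)|)%N by lia.
  by apply/card_gt0P; exists a; rewrite inE.
have [full cM] := support_full Y0 Z0 cYZ.
have cC := cardsC (Y :&: Z); rewrite card_ord cM in cC.
(* Of the p + 2 vertices, i + 1 are in the overlap: in the three cases none, at least two, or
   exactly one remain outside. *)
have [pi|pi|pi] := ltngtP p i.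
- rewrite /steenrod full cM !eqxx /=; apply/forallP => a; apply/implyP => aM.
  suff : (0 < #|~: (Y :&: Z)|)%N by lia.
  by apply/card_gt0P; exists a; rewrite inE.
- rewrite /steenrod full cM !eqxx /=; apply/forallP => a; apply/implyP => aM.
  have : (0 < #|~: (Y :&: Z) :\ a|)%N.
    have := cardsD1 a (~: (Y :&: Z)); rewrite inE aM; lia.
  case/card_gt0P => k /finset.setD1P[ka]; rewrite finset.in_setC => kM.
  case: (unliftP k a) ka => [a' aE _|->]; last by rewrite eqxx.
  pose Y1 := Y :\ k; pose Z1 := Z :\ k.
  have M1 : Y1 :&: Z1 = Y :&: Z.
    apply/setP => x; rewrite !inE; case: eqP => //= ->.
    by apply/esym/negbTE; rewrite inE in kM.
  have M0 : (0 < #|Y1 :&: Z1|)%N by rewrite M1 cM.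
  have Y10 : (0 < #|Y1|)%N by rewrite (leq_trans M0) // subset_leq_card // finset.subsetIl.
  have Z10 : (0 < #|Z1|)%N by rewrite (leq_trans M0) // subset_leq_card // finset.subsetIr.
  have kY1 : k \notin Y1 by rewrite !inE eqxx.
  have kZ1 : k \notin Z1 by rewrite !inE eqxx.
  have van q : vanishes_off_full (c q).
    move=> U V U0 V0; apply: contraNeq => /(support_full U0 V0)[-> _].
    by rewrite eqxx.
  (* The two ways of restoring [k] have the same overlap, so by [support_inj] only the one giving
     back [(Y, Z)] has a non-zero coefficient. *)
  have bd_neq0 : bd (c p.+1) Y1 Z1 != 0.
    rewrite (bd_one_missing (van _) Y10 Z10 kY1 kZ1).
    have [kY|kY] := boolP (k \in Y).
      have kZ : k \notin Z by move: kM; rewrite inE kY.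
      have -> : k |: Y1 = Y by rewrite finset.setD1K.
      have ZE : Z1 = Z by apply/finset.setDidPl; rewrite disjoint_sym disjoints1.
      suff -> : c p.+1 Y1 (k |: Z1) = 0.
        by rewrite mulr0 addr0 ZE mulf_neq0 // signr_eq0.
      apply/eqP/negPn/negP => c1; have e : Y :&: Z = Y1 :&: (k |: Z1).
        rewrite -M1; apply/setP => x; rewrite !inE.
        by case: eqP => //= ->.
      have L0 : (0 < #|Y :&: Z|)%N by rewrite cM.
      by have [/setP/(_ k) + _] := support_inj L0 e cYZ c1; rewrite (negPf kY1) kY.
    have kZ : k \in Z by move: (setU_eqT k full); rewrite (negPf kY).
    have -> : k |: Z1 = Z by rewrite finset.setD1K.
    have YE : Y1 = Y by apply/finset.setDidPl; rewrite disjoint_sym disjoints1.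
    suff -> : c p.+1 (k |: Y1) Z1 = 0.
      by rewrite mulr0 add0r YE mulf_neq0 // signr_eq0.
    apply/eqP/negPn/negP => c1; have e : Y :&: Z = (k |: Y1) :&: Z1.
      rewrite -M1; apply/setP => x; rewrite !inE.
      by case: eqP => //= ->.
    have L0 : (0 < #|Y :&: Z|)%N by rewrite cM.
    by have [_ /setP/(_ k)] := support_inj L0 e cYZ c1; rewrite (negPf kZ1) kZ.
  (* The right-hand side vanishes since [k] is uncovered, so the coface coefficient is non-zero and
     the induction hypothesis applies to it. *)
  have := c_eq Y10 Z10; rewrite symmetrized_off_full ?(not_full kY1) //.
  rewrite (cof_one_missing (van _) Y10 Z10 kY1 kZ1) => /eqP; rewrite subr_eq0.
  move=> /eqP bdE; rewrite bdE !mulf_eq0 !negb_or in bd_neq0.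
  case/and3P: bd_neq0 => _ _ /IH; rewrite !card_down // => /(_ Y10 Z10) st.
  have aM' : a' \notin fintype.lift k @^-1: Y1 :&: fintype.lift k @^-1: Z1.
    by move: aM; rewrite -M1 aE !inE.
  have := steenrod_mem st aM'.
  rewrite -(above_up k) -up_setI !up_down // M1 -aE => <-.
  have ak : a != k by rewrite aE eq_sym neq_lift.
  by rewrite inE -aE finset.in_setD1 ak.
subst p; have /eqP/cards1P[a aE] : #|~: (Y :&: Z)| = 1%N by lia.
have YZ : Y :&: Z = ~: [set a]%SET by rewrite -aE finset.setCK.
have b0E : b0 = left_full a (+) odd (above (top a) a) by exact: left_full_const.
have [[YE ZE]|[YE ZE]] := co_singleton_pair full YZ; move: cYZ; rewrite YE ZE.
  by rewrite -/(top a) -/(left_full a) steenrod_left b0E => ->; case: odd.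
rewrite -/(top a) -/(right_full a) steenrod_right b0E left_fullN => /negPf ->.
by case: odd.
Qed.


(** The overlap determines the term: the parity rule leaves no choice at the other vertices. *)
Lemma steenrod_inj n b m (Y Z Y' Z' : {set 'I_n}) :
    steenrod b m Y Z -> steenrod b m Y' Z' -> Y :&: Z = Y' :&: Z' ->
  Y = Y' /\ Z = Z'.
Proof.
move=> st st' e; have eP x := congr1 (fun W : {set 'I_n} => x \in W) e.
have YE x : (x \in Y) = (x \in Y').
  have [xM|xM] := boolP (x \in Y :&: Z); last first.
    by rewrite (steenrod_mem st xM) e (steenrod_mem st') -?e.
  by move: (eP x); rewrite xM; move: xM; rewrite !inE => /andP[-> _] /esym/andP[].
split; apply/setP => x //; have := eP x; rewrite !inE YE.
have := setU_eqT x (steenrod_full st); have := setU_eqT x (steenrod_full st').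
by rewrite YE; case: (x \in Y') => /= [_ _|-> ->].
Qed.

Lemma coproduct_table_steenrod : exists b, forall p (Y Z : {set 'I_p.+1}),
  (0 < #|Y|)%N -> (0 < #|Z|)%N -> c p Y Z = steenrod_coefficients b i.+1 p Y Z.
Proof.
exists b0 => p Y Z Y0 Z0; rewrite /steenrod_coefficients /steenrod_table.
have [cYZ|cYZ] := eqVneq (c p Y Z) 0; last first.
  rewrite (support_steenrod Y0 Z0 cYZ) mul1r.
  have [_ cM] := support_full Y0 Z0 cYZ.
  have := nrm_support (p := p) (Y := Y) (Z := Z).
  rewrite cM cYZ /nrm => /(_ isT) e.
  by rewrite -[LHS]mul1r -(sg_sqr Y Z) -mulrA e mulr1.
(* Some term of [c] has this overlap; it obeys the same rule [b0], so it is this very pair. *)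
case st: steenrod; rewrite ?mul0r //.
have [[Y' Z'] /= [full' e cYZ']] := parallel_exists (steenrod_card st).
have L0 : (0 < #|Y' :&: Z'|)%N by rewrite e (steenrod_card st).
have Y'0 : (0 < #|Y'|)%N by rewrite (leq_trans L0) // subset_leq_card // finset.subsetIl.
have Z'0 : (0 < #|Z'|)%N by rewrite (leq_trans L0) // subset_leq_card // finset.subsetIr.
have [YE ZE] := steenrod_inj st (support_steenrod Y'0 Z'0 cYZ') (esym e).
by move: cYZ'; rewrite -YE -ZE cYZ eqxx.
Qed.

End Comparison.

Lemma nterms_steenrod b m p :
  (nterms (steenrod_coefficients b m) p <=
   #|[set L : {set 'I_p.+1} | #|L| == m]%SET|)%N.
Proof.
rewrite /nterms; set S := [set YZ | _]%SET.
have stS YZ : YZ \in S -> steenrod b m YZ.1 YZ.2.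
  rewrite inE => /and3P[_ _]; rewrite /steenrod_coefficients /steenrod_table.
  by case: steenrod; rewrite ?mul0r ?eqxx.
rewrite -(card_in_imset (f := fun YZ => YZ.1 :&: YZ.2)) => [|[Y Z] [Y' Z']]; last first.
  by move=> /stS/= st /stS/= st' /= /(steenrod_inj st st')[-> ->].
apply: subset_leq_card; apply/fintype.subsetP => L /imsetP[YZ /stS st ->].
by rewrite inE (steenrod_card st).
Qed.

(** * Restrictions of singular simplices *)

Section Faces.
Variables (R : realType) (X : topologicalType).
Local Notation sing := (sing R X).
Local Notation chain2 := (chain2 R X).

Lemma affine_comp q k p (f : 'I_k.+1 -> 'I_p.+1) (g : 'I_q.+1 -> 'I_k.+1)
    (t : simplex R q) :
  affine f (affine g t) = affine (f \o g) t.
Proof.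
apply: val_inj; rewrite /= /affine_fun !set_valE /= /affine_fun.
under eq_bigr => a _.
  rewrite summxE scaler_suml.
  under eq_bigr => b _ do rewrite mxE mxE eqxx /= -scalerA.
  over.
rewrite exchange_big /=; apply: eq_bigr => b _.
rewrite -scaler_sumr (bigD1 (g b)) //= eqxx scale1r big1 ?addr0 // => a /negPf ab.
by rewrite ab scale0r.
Qed.

(** The dimensions [k] and [k'] are only propositionally equal; comparing the vertex maps through
    the values of ordinals avoids a transport. *)
Lemma tagged_face p (s : ssimplex R X p) k k'
    (f : 'I_k.+1 -> 'I_p.+1) (f' : 'I_k'.+1 -> 'I_p.+1) :
    k = k' -> (forall a a', nat_of_ord a = nat_of_ord a' -> f a = f' a') ->
  Tagged (@ssimplex R X) (s \o affine (R := R) f : continuousType _ _) =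
  Tagged (@ssimplex R X) (s \o affine (R := R) f' : continuousType _ _).
Proof.
move=> kk'; case: _ / kk' f' => f' ff'.
by have -> : f = f' by apply/funext => a; exact: ff'.
Qed.

Lemma ltn_mono_inj q p (f : 'I_q -> 'I_p) :
  {mono f : x y / (x < y)%N} -> injective f.
Proof.
move=> f_mono x y fxy; apply: val_inj.
by case: (ltngtP x y) => // xy; move: xy; rewrite -f_mono fxy ltnn.
Qed.

Lemma sorted_enum_ord n (W : {set 'I_n}) :
  sorted (fun x y : 'I_n => (x < y)%N) (enum W).
Proof.
rewrite {1}/enum_mem sorted_filter //; first by move=> ? ? ?; exact: ltn_trans.
by rewrite -(sorted_map (e' := ltn)) -enumT val_enum_ord iota_ltn_sorted.
Qed.

Lemma enum_imset_mono q p (f : 'I_q -> 'I_p) (Y : {set 'I_q}) :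
    {mono f : x y / (x < y)%N} -> enum (f @: Y)%SET = map f (enum Y).
Proof.
move=> f_mono.
apply: (irr_sorted_eq (leT := fun x y : 'I_p => (x < y)%N)).
- by move=> ? ? ?; exact: ltn_trans.
- by move=> ?; exact: ltnn.
- exact: sorted_enum_ord.
- rewrite sorted_map; apply: sub_sorted (sorted_enum_ord _) => x y /=.
  by rewrite f_mono.
move=> x; rewrite mem_enum; apply/imsetP/mapP => -[y yY ->]; exists y => //.
  by rewrite mem_enum.
by move: yY; rewrite mem_enum.
Qed.

(** A strictly increasing vertex map commutes with increasing enumeration, so a face of a face is
    the face on the image vertices. *)
Lemma restr_comp q p (s : ssimplex R X p) (f : 'I_q.+1 -> 'I_p.+1)
    (Y : {set 'I_q.+1}) : {mono f : x y / (x < y)%N} -> (0 < #|Y|)%N ->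
  restr (s \o affine (R := R) f : continuousType _ _) Y = restr s (f @: Y)%SET.
Proof.
move=> f_mono Y0; have f_inj := ltn_mono_inj f_mono.
transitivity (Tagged (@ssimplex R X)
    (s \o affine (R := R) (f \o @vertex_of q Y) : continuousType _ _)).
  congr Tagged; apply/continuousEP => t /=.
  by rewrite affine_comp.
apply: tagged_face => [|a a' aa']; first by rewrite card_imset.
rewrite /= /vertex_of enum_imset_mono // -aa' (nth_map ord0) //.
by rewrite -cardE (leq_trans (ltn_ord a)) // prednK.
Qed.


Lemma nth_vertex_of p (Y : {set 'I_p.+1}) (a : 'I_(#|Y|.-1.+1)) : (0 < #|Y|)%N ->
  (a < size (enum Y))%N.
Proof. by move=> Y0; rewrite -cardE (leq_trans (ltn_ord a)) // prednK. Qed.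

Lemma vertex_of_mem p (Y : {set 'I_p.+1}) (a : 'I_(#|Y|.-1.+1)) :
  (0 < #|Y|)%N -> vertex_of a \in Y.
Proof. by move=> Y0; rewrite -mem_enum mem_nth // nth_vertex_of. Qed.

Lemma vertex_of_mono p (Y : {set 'I_p.+1}) : (0 < #|Y|)%N ->
  {mono @vertex_of p Y : x y / (x < y)%N}.
Proof.
move=> Y0; have h (x y : 'I_(#|Y|.-1.+1)) : (x < y)%N ->
    (vertex_of x < vertex_of y)%N.
  move=> xy; apply: (sorted_ltn_nth (leT := fun x y : 'I_p.+1 => (x < y)%N)) => //.
  - by move=> ? ? ?; exact: ltn_trans.
  - exact: sorted_enum_ord.
  - by rewrite inE nth_vertex_of.
  - by rewrite inE nth_vertex_of.
move=> x y; case: (ltngtP x y) => [/h //|/h yx|/val_inj ->]; last by rewrite ltnn.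
by apply/negbTE; rewrite -leqNgt ltnW.
Qed.

Lemma vertex_of_imset p (Y : {set 'I_p.+1}) : (0 < #|Y|)%N ->
  ([set vertex_of a | a : 'I_(#|Y|.-1.+1)] = Y)%SET.
Proof.
move=> Y0; apply/eqP; rewrite eqEcard; apply/andP; split.
  by apply/fintype.subsetP => _ /imsetP[a _ ->]; exact: vertex_of_mem.
rewrite card_imset ?card_ord ?prednK //.
exact: ltn_mono_inj (vertex_of_mono Y0).
Qed.

Lemma below_vertex_of p (Y : {set 'I_p.+1}) (k : 'I_(#|Y|.-1.+1)) :
  (0 < #|Y|)%N -> below Y (vertex_of k) = k.
Proof.
move=> Y0; have inj := ltn_mono_inj (vertex_of_mono Y0).
have memE y : (y \in Y) = (y \in [set vertex_of a | a : 'I_(#|Y|.-1.+1)]%SET).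
  by rewrite vertex_of_imset.
rewrite /below (eq_bigl _ _ memE) big_imset /=; last by move=> x y _ _; exact: inj.
under eq_bigr do rewrite vertex_of_mono //.
rewrite (eq_bigl xpredT) => [|x]; last by rewrite inE.
by rewrite sum_ltn // ltnW.
Qed.

(** The k-th face omits the vertex of [Y] with k vertices of [Y] below it. The condition
    [0 < #|Y :\ y|] makes the sum empty for a 0-simplex. *)
Lemma boundary_restr p (s : ssimplex R X p) (Y : {set 'I_p.+1}) : (0 < #|Y|)%N ->
  boundary R X << restr s Y >> =
  \sum_(y | (y \in Y) && (0 < #|Y :\ y|)%N)
    (-1) ^+ below Y y *: << restr s (Y :\ y) >>.
Proof.
move=> Y0; rewrite /boundary lin_extU /boundary_simplex.
have cD y : y \in Y -> #|Y :\ y| = #|Y|.-1.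
  by move=> yY; rewrite (cardsD1 y Y) yY.
case: ifP => [/eqP /= t0|/negbT].
  rewrite big_pred0 // => y; apply/negbTE/negP => /andP[yY].
  by rewrite cD // t0.
rewrite -lt0n => /= t0.
have inj := ltn_mono_inj (vertex_of_mono Y0).
rewrite (eq_bigl (fun y => y \in ([set vertex_of a | a : 'I_(#|Y|.-1.+1)])%SET)); last first.
  move=> y; rewrite vertex_of_imset //; case yY: (y \in Y) => //=.
  by rewrite cD // t0.
rewrite big_imset /=; last by move=> x y _ _; exact: inj.
rewrite [RHS](eq_bigl xpredT) => [|k]; last by rewrite inE.
apply: eq_bigr => k _; congr (_ ^+ _ *: << _ >>).
  by rewrite below_vertex_of.
rewrite restr_comp; last 2 first.
- exact: vertex_of_mono.
- by rewrite cardsC1 card_ord /=.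
congr restr; apply/setP => x.
apply/imsetP/finset.setD1P => [[a ak ->]|[xk xY]].
  rewrite (inj_eq inj) vertex_of_mem //; split=> //.
  by move: ak; rewrite !inE.
move: xY; rewrite -{1}(vertex_of_imset Y0) => /imsetP[a _ xa].
by exists a => //; rewrite !inE; apply: contraNneq xk => <-; rewrite xa.
Qed.

Lemma restr_co_vertex p (s : ssimplex R X p.+1) (k : 'I_p.+2) :
  restr s [set~ k]%SET = Tagged (@ssimplex R X)
    (s \o affine (R := R) (fintype.lift k) : continuousType _ _).
Proof.
apply: tagged_face => [|a a' aa']; first by rewrite cardsC1 card_ord.
have kE : [set~ k]%SET = (fintype.lift k @: [set: 'I_p.+1])%SET.
  apply/setP => x; case: (unliftP k x) => [y ->|->].
    by rewrite mem_up !inE eq_sym (negPf (neq_lift _ _)).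
  by rewrite (negPf (notin_up _ _)) !inE eqxx.
rewrite /vertex_of aa' kE enum_imset_mono; last exact: lift_ltn.
rewrite (nth_map ord0) -?cardE ?cardsT ?card_ord //; congr fintype.lift.
apply: val_inj; rewrite -(nth_map ord0 0%N) -?cardE ?cardsT ?card_ord //.
by rewrite enum_setT -enumT val_enum_ord nth_iota.
Qed.

End Faces.

Section Reindexing.
Variable V : lmodType int.

(** This transposes the boundary: deleting a vertex from each face becomes adding one to each face,
    the form used in [bd]. *)
Lemma sum_remove n (F : {set 'I_n} -> 'I_n -> V) :
  \sum_(Y : {set 'I_n} | (0 < #|Y|)%N)
    \sum_(y | (y \in Y) && (0 < #|Y :\ y|)%N) F Y y =
  \sum_(Y : {set 'I_n} | (0 < #|Y|)%N) \sum_(y | y \notin Y) F (y |: Y) y.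
Proof.
rewrite (exchange_big_dep xpredT) //= [RHS](exchange_big_dep xpredT) //=.
apply: eq_bigr => y _.
rewrite (reindex_onto (fun Y => y |: Y) (fun Y => Y :\ y)) /=; last first.
  by move=> Y /andP[_ /andP[yY _]]; rewrite finset.setD1K.
apply: eq_bigl => Y; have -> : (0 < #|y |: Y|)%N = true by rewrite card_gt0U1.
rewrite setU11 /=; case yY: (y \in Y) => /=; last by rewrite finset.setU1K ?yY // eqxx !andbT.
rewrite andbF; apply/negbTE/negP => /andP[_ /eqP/setP/(_ y)].
by rewrite yY !inE eqxx.
Qed.

Lemma sum_coface p (k : 'I_p.+2) (F : {set 'I_p.+2} -> V) :
  \sum_(Y : {set 'I_p.+2} | (0 < #|Y|)%N && (k \notin Y)) F Y =
  \sum_(Y : {set 'I_p.+1} | (0 < #|Y|)%N) F (fintype.lift k @: Y)%SET.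
Proof.
rewrite (reindex_onto (fun Y : {set 'I_p.+1} => fintype.lift k @: Y)%SET
  (fun Y : {set 'I_p.+2} => fintype.lift k @^-1: Y)%SET) /=; last first.
  by move=> Y /andP[_ kY]; exact: up_down.
by apply: eq_bigl => Y; rewrite card_up notin_up down_up eqxx !andbT.
Qed.

End Reindexing.

(** * From identities of chains to identities of coefficients *)

Section Formulas.
Variables (R : realType) (X : topologicalType).
Local Notation chain := (chain R X).
Local Notation chain2 := (chain2 R X).

Definition table n := {set 'I_n} -> {set 'I_n} -> int.

Lemma chain_linear_ext (M : lmodType int) (f g : chain -> M) :
  linear f -> linear g -> (forall s, f << s >> = g << s >>) -> f =1 g.
Proof.
move=> fl gl fg x.
by rewrite (lin_ext_unique fl fg) (lin_ext_unique gl (fun s => erefl)).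
Qed.

Lemma linear_addZ (f g : chain -> chain2) (k : int) :
  linear f -> linear g -> linear (fun x => f x + k *: g x).
Proof.
move=> fl gl a x y; rewrite fl gl !scalerDr !scalerA (mulrC a).
by rewrite addrACA.
Qed.

Lemma formula_valueE p (e : table p.+1) (s : ssimplex R X p) :
  formula_value e s = \sum_(Y : {set 'I_p.+1} | (0 < #|Y|)%N)
    \sum_(Z : {set 'I_p.+1} | (0 < #|Z|)%N) e Y Z *: << (restr s Y, restr s Z) >>.
Proof.
by apply: eq_bigr => Y _; apply: eq_bigr => Z _; rewrite tensorU.
Qed.

Lemma eq_formula_value p (e e' : table p.+1) (s : ssimplex R X p) :
    (forall Y Z : {set 'I_p.+1}, (0 < #|Y|)%N -> (0 < #|Z|)%N -> e Y Z = e' Y Z) ->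
  formula_value e s = formula_value e' s.
Proof.
by move=> ee; apply: eq_bigr => Y Y0; apply: eq_bigr => Z Z0; rewrite ee.
Qed.

Lemma formula_valueD p (e e' : table p.+1) (s : ssimplex R X p) :
  formula_value (fun Y Z => e Y Z + e' Y Z) s =
  formula_value e s + formula_value e' s.
Proof.
rewrite /formula_value -big_split; apply: eq_bigr => Y _ /=.
by rewrite -big_split; apply: eq_bigr => Z _; rewrite scalerDl.
Qed.

Lemma formula_valueZ p a (e : table p.+1) (s : ssimplex R X p) :
  formula_value (fun Y Z => a * e Y Z) s = a *: formula_value e s.
Proof.
rewrite /formula_value scaler_sumr; apply: eq_bigr => Y _.
by rewrite scaler_sumr; apply: eq_bigr => Z _; rewrite scalerA.
Qed.

Lemma formula_valueB p (e e' : table p.+1) (s : ssimplex R X p) :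
  formula_value (fun Y Z => e Y Z - e' Y Z) s =
  formula_value e s - formula_value e' s.
Proof.
rewrite formula_valueD -[- formula_value e' s]scaleN1r -formula_valueZ.
by congr (_ + _); apply: eq_formula_value => Y Z _ _; rewrite mulN1r.
Qed.

Lemma tensor_suml (I : finType) (P : pred I) (a : I -> int) (F : I -> chain) y :
  tensor (\sum_(i | P i) a i *: F i) y = \sum_(i | P i) a i *: tensor (F i) y.
Proof.
have lin := tensor_linearl y; pose f : {linear chain -> chain2} :=
  HB.pack (fun x => tensor x y) (GRing.isLinear.Build int _ _ *:%R _ lin).
rewrite -[LHS]/(f _) raddf_sum; apply: eq_bigr => i _.
exact: (linearZ_LR f).
Qed.

Lemma tensor_sumr (I : finType) (P : pred I) (a : I -> int) (F : I -> chain) x :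
  tensor x (\sum_(i | P i) a i *: F i) = \sum_(i | P i) a i *: tensor x (F i).
Proof.
have lin := tensor_linearr x; pose f : {linear chain -> chain2} :=
  HB.pack (tensor x) (GRing.isLinear.Build int _ _ *:%R _ lin).
rewrite -[LHS]/(f _) raddf_sum; apply: eq_bigr => i _.
exact: (linearZ_LR f).
Qed.

Lemma boundary2_formula p (e : table p.+1) (s : ssimplex R X p) :
  boundary2 R X (formula_value e s) = formula_value (bd e) s.
Proof.
pose g (Y Z : {set 'I_p.+1}) : chain2 := << (restr s Y, restr s Z) >>.
pose F1 (Z Y : {set 'I_p.+1}) (y : 'I_p.+1) :=
  (e Y Z * (-1) ^+ below Y y) *: g (Y :\ y) Z.
pose F2 (Y Z : {set 'I_p.+1}) (z : 'I_p.+1) :=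
  (e Y Z * (-1) ^+ (#|Y|.+1 + below Z z)) *: g Y (Z :\ z).
have step (Y Z : {set 'I_p.+1}) : (0 < #|Y|)%N -> (0 < #|Z|)%N ->
    boundary2 R X (e Y Z *: g Y Z) =
    \sum_(y | (y \in Y) && (0 < #|Y :\ y|)%N) F1 Z Y y +
    \sum_(z | (z \in Z) && (0 < #|Z :\ z|)%N) F2 Y Z z.
  move=> Y0 Z0; rewrite linearZ /= /boundary2 lin_extU !boundary_restr //=.
  rewrite tensor_suml tensor_sumr scalerDr scalerA 2!scaler_sumr; congr (_ + _).
    by apply: eq_bigr => y _; rewrite tensorU scalerA.
  apply: eq_bigr => z _; rewrite tensorU scalerA -mulrA -exprD.
  (* The dimension [#|Y|.-1] and [#|Y|.+1] have the same parity because [Y] is non-empty. *)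
  congr ((_ * _) *: _); apply: eq_sign; rewrite !oddD.
  by case: #|Y| Y0 => //= m; rewrite negbK.
rewrite formula_valueE linear_sum.
under eq_bigr => Y Y0.
  rewrite linear_sum; under eq_bigr => Z Z0 do rewrite step //.
  rewrite big_split /=; over.
rewrite big_split /= [X in X + _]exchange_big /=.
under eq_bigr => Z _ do rewrite sum_remove.
under [X in _ + X]eq_bigr => Y _ do rewrite sum_remove.
rewrite [X in X + _]exchange_big /=.
rewrite formula_valueE -big_split /=; apply: eq_bigr => Y _.
rewrite -big_split /=; apply: eq_bigr => Z _.
rewrite /bd scalerDl !scaler_suml; congr (_ + _).
  apply: eq_bigr => y yY; rewrite /F1 finset.setU1K // belowU1 // ltnn add0n.
  by rewrite mulrC.
apply: eq_bigr => z zZ; rewrite /F2 finset.setU1K // belowU1 // ltnn add0n.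
by rewrite mulrC.
Qed.

Lemma swap_formula p (e : table p.+1) (s : ssimplex R X p) :
  swap R X (formula_value e s) =
  formula_value (fun Y Z => (-1) ^+ (#|Y|.-1 * #|Z|.-1) * e Z Y) s.
Proof.
rewrite !formula_valueE exchange_big linear_sum; apply: eq_bigr => Y _.
rewrite linear_sum; apply: eq_bigr => Z _.
rewrite linearZ /= /swap lin_extU tensorU /= !scalerA mulnC.
by congr (_ *: _); rewrite mulrC.
Qed.

Lemma coface_formula (D : {linear chain -> chain2}) c p (s : ssimplex R X p) :
  given_by c D ->
  D (boundary R X << Tagged (@ssimplex R X) s >>) = formula_value (@cof c p) s.
Proof.
move=> Dc; rewrite /boundary lin_extU /boundary_simplex /=.
case: p s => [|p] s /=.
  rewrite linear0 formula_valueE big1 // => Y _; rewrite big1 // => Z _.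
  by rewrite scale0r.
rewrite linear_sum formula_valueE.
pose F (k : 'I_p.+2) (Y Z : {set 'I_p.+2}) : chain2 :=
  ((-1) ^+ k * c p (fintype.lift k @^-1: Y)%SET (fintype.lift k @^-1: Z)%SET) *:
  << (restr s Y, restr s Z) >>.
rewrite [RHS](eq_bigr (fun Y : {set 'I_p.+2} => \sum_(k | k \notin Y)
    \sum_(Z : {set 'I_p.+2} | (0 < #|Z|)%N && (k \notin Z)) F k Y Z)); last first.
  move=> Y _; under eq_bigr => Z _ do rewrite scaler_suml.
  rewrite (exchange_big_dep (fun k => k \notin Y)) /= => [|Z k _ /andP[] //].
  by apply: eq_bigr => k kY; apply: eq_bigl => Z; rewrite kY.
rewrite (exchange_big_dep xpredT) //=; apply: eq_bigr => k _.
rewrite linearZ /= restr_co_vertex Dc formula_valueE sum_coface.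
rewrite scaler_sumr; apply: eq_bigr => Y Y0.
rewrite sum_coface scaler_sumr; apply: eq_bigr => Z Z0.
by rewrite /F !down_up scalerA !restr_comp //; exact: lift_ltn.
Qed.

Lemma Aset_steenrod n (L : {set 'I_n.+1}) :
  Aset L = [set a | (a \notin L) && odd (above L a)]%SET.
Proof. by apply/setP => a; rewrite !inE aboveE. Qed.

(** Sending L to the pair [(L :|: Aset L, ~: Aset L)] is a bijection onto Steenrod's terms, with
    inverse the overlap, and it matches the signs. *)
Lemma Delta_simplex_formula n p (s : ssimplex R X p) :
  Delta_simplex n s = formula_value (steenrod_coefficients false n.+1 p) s.
Proof.
rewrite formula_valueE pair_big_dep /= /Delta_simplex.
have AL (L : {set 'I_p.+1}) : Aset L \subset ~: L.
  by apply/fintype.subsetP => a; rewrite Aset_steenrod !inE => /andP[].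
have BE (L : {set 'I_p.+1}) : L :|: Bset L = ~: Aset L.
  apply/setP => a; have := fintype.subsetP (AL L) a; rewrite /Bset !inE -/(Aset L).
  by case: (a \in L); case: (a \in Aset L) => // /(_ isT).
have stA (L : {set 'I_p.+1}) : #|L| = n.+1 ->
    steenrod false n.+1 (L :|: Aset L) (~: Aset L).
  by move=> cL; rewrite steenrod_pair // Aset_steenrod.
rewrite [RHS](bigID (fun YZ => steenrod false n.+1 YZ.1 YZ.2)) /=.
rewrite [X in _ + X]big1 ?addr0 => [|YZ /andP[_ /negPf st]]; last first.
  by rewrite /steenrod_coefficients /steenrod_table st mul0r scale0r.
rewrite [RHS](reindex_onto (fun L => (L :|: Aset L, ~: Aset L))
  (fun YZ => YZ.1 :&: YZ.2)) /=; last first.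
  move=> [Y Z] /= /andP[_ st]; have cM := steenrod_card st.
  have e : (Y :&: Z :|: Aset (Y :&: Z)) :&: ~: Aset (Y :&: Z) = Y :&: Z.
    by rewrite pairI.
  by have [-> ->] := steenrod_inj (stA _ cM) st e.
apply: eq_big => [L|L /eqP cL].
  rewrite pairI // eqxx andbT; apply/eqP/andP => [cL|[_ /steenrod_card]]; last first.
    by rewrite pairI.
  have L0 : (0 < #|L|)%N by rewrite cL.
  rewrite stA //; split=> //; rewrite !(leq_trans L0) // subset_leq_card //.
    by rewrite -BE finset.subsetUl.
  exact: finset.subsetUl.
rewrite BE tensorU; congr (_ *: _).
rewrite /steenrod_coefficients /steenrod_table stA // mul1r /sg /sg_exponent.
have -> : (L :|: Aset L) :\: ~: Aset L = Aset L.
  apply/setP => a; rewrite !(finset.in_setD, finset.in_setC, finset.in_setU).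
  by case: (a \in Aset L); rewrite ?orbT.
have -> : ~: Aset L :\: (L :|: Aset L) = Bset L.
  apply/setP => a; rewrite /Bset !(finset.in_setD, finset.in_setC, finset.in_setU).
  by case: (a \in Aset L); rewrite ?orbT ?andbT.
rewrite pairI //; congr (_ ^+ _); rewrite /sign_exponent; congr (_ + _ + _)%N.
  by apply: eq_bigr => a _; rewrite belowE.
by apply: eq_bigr => a _; rewrite belowE.
Qed.

Lemma Delta_formula i p (s : ssimplex R X p) :
  Delta R X (i%:Z - 1) << Tagged (@ssimplex R X) s >> =
  formula_value (steenrod_coefficients false i p) s.
Proof.
case: i => [|i]; last first.
  rewrite (_ : i.+1%:Z - 1 = i%:Z); last by lia.
  by rewrite /Delta lin_extU Delta_simplex_formula.
rewrite /Delta lin_extU /=.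
rewrite formula_valueE big1 // => Y Y0; rewrite big1 // => Z Z0.
rewrite /steenrod_coefficients /steenrod_table.
case st: steenrod; last by rewrite mul0r scale0r.
(* In degree -1 the overlap would be empty, so every count [above] would be 0 and the parity rule
   would empty [Y]. *)
case/card_gt0P: Y0 => a aY; have /eqP := steenrod_card st.
rewrite cards_eq0 => /eqP M0; have := steenrod_mem (a := a) st.
by rewrite M0 inE aY /above big_set0 => /(_ isT).
Qed.

Lemma coproduct_equation_table i (D : {linear chain -> chain2}) c :
  given_by c D -> coproduct_table i c -> coproduct_equation i D.
Proof.
move=> Dc c_eq x; rewrite -scaleNr; move: x; apply: chain_linear_ext.
- by apply: linear_addZ => a x y; rewrite !linearP.
- by apply: linear_addZ => a x y; rewrite !linearP.
case=> p s; rewrite scaleNr -[existT _ _ _]/(Tagged (@ssimplex R X) s).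
rewrite Dc boundary2_formula (coface_formula _ Dc) Delta_formula swap_formula.
rewrite -!formula_valueZ -formula_valueB -formula_valueD.
by apply: eq_formula_value => Y Z Y0 Z0; exact: c_eq.
Qed.

(** Determinacy of formulas allows an equality of values on all simplices of X to be read
    coefficient by coefficient. *)
Lemma table_coproduct_equation i (D : {linear chain -> chain2}) c :
  formulas_determined R X -> given_by c D -> coproduct_equation i D ->
  coproduct_table i c.
Proof.
move=> det Dc D_eq p Y Z Y0 Z0; apply/eqP; rewrite -subr_eq0; apply/eqP.
apply: (det p (fun Y Z => bd (c p) Y Z - (-1) ^+ i * @cof c p Y Z -
  symmetrized i Y Z)) => // s.
pose sw (Y Z : {set 'I_p.+1}) : int := (-1) ^+ (#|Y|.-1 * #|Z|.-1) *
  steenrod_coefficients false i p Z Y.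
rewrite (formula_valueB (fun Y Z => bd (c p) Y Z - (-1) ^+ i * @cof c p Y Z)
  (fun Y Z => steenrod_coefficients false i p Y Z + (-1) ^+ i * sw Y Z)).
rewrite (formula_valueB (bd (c p)) (fun Y Z => (-1) ^+ i * @cof c p Y Z)).
rewrite formula_valueZ (formula_valueD _ (fun Y Z => (-1) ^+ i * sw Y Z)).
rewrite (formula_valueZ _ sw) -swap_formula -Delta_formula.
by rewrite -boundary2_formula -(coface_formula _ Dc) -Dc D_eq subrr.
Qed.

End Formulas.

(** * Steenrod's coproduct as a competitor, and the conclusion *)

Section Admissibility.
Variables (R : realType) (X : topologicalType) (i : nat).
Local Notation chain := (chain R X).
Local Notation chain2 := (chain2 R X).
Local Notation steen := (steenrod_coefficients false i.+1).

Lemma steenrod_given_by : given_by steen (Delta R X i%:Z).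
Proof.
by move=> p s; rewrite /Delta lin_extU Delta_simplex_formula.
Qed.

Lemma Delta_has_degree : has_degree i (Delta R X i%:Z).
Proof.
move=> [p s] st; rewrite -[existT _ _ _]/(Tagged (@ssimplex R X) s).
rewrite steenrod_given_by formula_valueE; rewrite mem_dom => nz.
have [YZ [Y0 Z0 stYZ ->]] : exists YZ : {set 'I_p.+1} * {set 'I_p.+1},
    [/\ (0 < #|YZ.1|)%N, (0 < #|YZ.2|)%N, steenrod false i.+1 YZ.1 YZ.2 &
      st = (restr s YZ.1, restr s YZ.2)].
  apply/not_existsP => none; move/eqP: nz; apply.
  rewrite raddf_sum big1 // => Y Y0; rewrite raddf_sum big1 // => Z Z0 /=.
  rewrite coeffZ coeffU; have [e|] := eqVneq; last by rewrite !mulr0.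
  rewrite /steenrod_coefficients /steenrod_table.
  case stYZ: steenrod; last by rewrite !mul0r.
  by case: (none (Y, Z)); split; rewrite // e.
rewrite /= /restr /=; have := cardsUI YZ.1 YZ.2.
rewrite (steenrod_full stYZ) (steenrod_card stYZ) cardsT card_ord.
by move: Y0 Z0; case: #|YZ.1| => // m _; case: #|YZ.2| => // n _ /=; lia.
Qed.

Lemma restr_point (s : ssimplex R X 0) :
  restr s [set: 'I_1]%SET = Tagged (@ssimplex R X) s.
Proof.
transitivity (Tagged (@ssimplex R X) (s \o affine (R := R) id : continuousType _ _)).
  apply: tagged_face => [|a a' _]; first by rewrite cardsT card_ord.
  by rewrite (ord1 (vertex_of a)) (ord1 a').
congr Tagged; apply/continuousEP => t /=; congr (s _).
apply: val_inj; rewrite /= /affine_fun set_valE; apply/rowP => j.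
by rewrite big_ord1 !mxE (ord1 j) eqxx mulr1.
Qed.

Lemma formula_value_point (e : {set 'I_1} -> {set 'I_1} -> int) (s : ssimplex R X 0) :
  formula_value e s = e [set: 'I_1]%SET [set: 'I_1]%SET *:
    tensor << Tagged (@ssimplex R X) s >> << Tagged (@ssimplex R X) s >>.
Proof.
have pt (Y : {set 'I_1}) : (0 < #|Y|)%N = (Y == [set: 'I_1]%SET).
  apply/card_gt0P/eqP => [[x xY]|->]; last by exists ord0; rewrite inE.
  by apply/setP => y; rewrite inE (ord1 y) -(ord1 x) xY.
rewrite /formula_value (eq_bigl _ _ pt) big_pred1_eq (eq_bigl _ _ pt) big_pred1_eq.
by rewrite restr_point.
Qed.

(** This puts Steenrod's coproduct among those against which minimality is tested, which bounds the
    number of terms of a minimal one. *)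
Lemma Delta_admissible : admissible i (Delta R X i%:Z) steen.
Proof.
split.
- exact: Delta_has_degree.
- exact: steenrod_given_by.
- exact: coproduct_equation_table steenrod_given_by (@steenrod_coproduct_table i).
move=> i0 [p s] /= p0; move: s; rewrite p0 => s.
rewrite -[existT _ _ _]/(Tagged (@ssimplex R X) s) steenrod_given_by i0.
by rewrite formula_value_point /steenrod_coefficients steenrod_table_point scale1r.
Qed.

Lemma normalized_coefficient (D : {linear chain -> chain2}) (c : coefficients) :
    formulas_determined R X -> given_by c D ->
    (forall s : sing R X, tag s = 0%N -> D << s >> = tensor << s >> << s >>) ->
  c 0%N [set: 'I_1]%SET [set: 'I_1]%SET = 1.
Proof.
move=> det Dc D1; apply/eqP; rewrite -subr_eq0; apply/eqP.
apply: (det 0%N (fun Y Z => c 0%N Y Z - 1)) => [s||]; rewrite ?cardsT ?card_ord //.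
rewrite formula_value_point scalerBl scale1r -formula_value_point -Dc.
by rewrite D1 ?subrr.
Qed.

End Admissibility.

Theorem theorem4p7 (R : realType) (X : topologicalType) (i : nat)
    (D : {linear chain R X -> chain2 R X}) (c : coefficients) :
  formulas_determined R X ->
  admissible i D c ->
  (forall (D' : {linear chain R X -> chain2 R X}) (c' : coefficients),
      admissible i D' c' -> forall p : nat, (nterms c p <= nterms c' p)%N) ->
  (forall x : chain R X, D x = Delta R X i%:Z x) \/
  (forall x : chain R X, D x = (-1) ^+ i *: swap R X (Delta R X i%:Z x)).
Proof.
move=> det [_ Dc D_eq D1] D_min.
have c_eq := table_coproduct_equation det Dc D_eq.
have c_norm i0 := normalized_coefficient det Dc (D1 i0).
have c_min p := leq_trans (D_min _ _ (@Delta_admissible R X i) p)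
  (nterms_steenrod false i.+1 p).
have [[] cE] := coproduct_table_steenrod c_eq c_norm c_min; [right|left].
  apply: chain_linear_ext => [a x y|a x y|[p s]]; first by rewrite linearP.
    rewrite [Delta R X _ _]linearP [swap R X _]linearP scalerDr !scalerA.
    by rewrite (mulrC a).
  rewrite -[existT _ _ _]/(Tagged (@ssimplex R X) s) Dc steenrod_given_by.
  rewrite swap_formula -formula_valueZ; apply: eq_formula_value => Y Z Y0 Z0.
  (* The overlap has size i + 1, so [swap_steenrod_table] carries the sign (-1)^(i+1); its minus
     sign compensates for the extra factor. *)
  rewrite cE //; apply: oppr_inj; rewrite /steenrod_coefficients.
  by rewrite -(swap_steenrod_table false) // exprS mulN1r mulNr.
apply: chain_linear_ext => [a x y|a x y|[p s]]; [exact: linearP|exact: linearP|].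
rewrite -[existT _ _ _]/(Tagged (@ssimplex R X) s) Dc steenrod_given_by.
by apply: eq_formula_value => Y Z Y0 Z0; rewrite cE.
Qed.
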